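(* Let $T\colon R^{p,0}_\omega\to R^{p,0}_\omega$ be a bounded linear operator and $0<\epsilon<1$. Then either $T$ or $I-T$ is a $\frac{4}{1-\epsilon}(p^*-1)^2\big(\frac{p^*}{2}\big)^{3/2}$-factor of the identity $I$ on $R^{p,0}_\omega$; that is, for $S=T$ or $S=I-T$ there exist bounded operators $A,B$ on $R^{p,0}_\omega$ with $ASB=I$ and $\|A\|\|B\|\le\frac{4}{1-\epsilon}(p^*-1)^2\big(\frac{p^*}{2}\big)^{3/2}$.
   Context: Fix $1<p<\infty$, $q=p/(p-1)$, $p^*=\max\{p,q\}$. All $L_r$ spaces are over $[0,1]$ with Lebesgue measure. A dyadic interval is $[(i-1)2^{-n},i2^{-n})$, $n\ge0$, $1\le i\le2^n$; $\mathcal D^n$ is the set of those of length $2^{-n}$ and $\mathcal D_n=\bigcup_{k=0}^n\mathcal D^k$. For a dyadic interval $I$, $I^+,I^-$ are its left and right halves and $h_I=\chi_{I^+}-\chi_{I^-}$. For each $n\in\mathbb N$ a family $(h^n_I)_{I\in\mathcal D_{n-1}}$ in $L_p$ is fixed with the same joint distribution as $(h_I)_{I\in\mathcal D_{n-1}}$, such that the $\sigma$-algebras $\sigma(h^n_I:I\in\mathcal D_{n-1})$, $n\in\mathbb N$, are independent. Let $\mathcal D_\omega=\{(n,I):n\in\mathbb N,I\in\mathcal D_{n-1}\}$. $R^{p,0}_\omega$ is the closed linear span of $\{h^n_I:(n,I)\in\mathcal D_\omega\}$ in $L_p$ (a distributional copy of the mean-zero hyperplane of the Bourgain–Rosenthal–Schechtman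 space $R^p_\omega$). *)

(* Defs.v *)
From HB Require Import structures.
From mathcomp Require Import all_boot all_order all_algebra.
From mathcomp Require Import all_classical all_reals all_analysis.

Set Implicit Arguments.
Unset Strict Implicit.
Unset Printing Implicit Defensive.

Import Order.TTheory GRing.Theory Num.Theory numFieldNormedType.Exports.
Local Open Scope classical_set_scope.
Local Open Scope ring_scope.

(* Scalars: an arbitrary realType R.
   L_p spaces are over [0,1] with Lebesgue measure; elements are represented
   by (Borel measurable) functions R -> R, identified up to a.e. equality on
   [0,1]. *)

Section Defs.
Context {R : realType}.

Definition mu01 : {measure set (measurableTypeR R) -> \bar R} :=
  mrestr (@lebesgue_measure R) (measurable_itv `[(0:R), 1]).

Definition pnorm (p : R) (f : R -> R) : \bar R :=
  Lnorm mu01 p%:E (EFin \o f).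

Definition aeq (f g : R -> R) : Prop := {ae mu01, forall x, f x = g x}.

Definition qconj (p : R) : R := p / (p - 1).
Definition pstar (p : R) : R := Num.max p (qconj p).

(* the Haar function h_I for the dyadic interval
   I = [i 2^-k, (i+1) 2^-k)  (0-based i < 2^k):  h_I = chi_{I^+} - chi_{I^-} *)
Definition haar (k i : nat) : R -> R := fun x =>
  \1_(`[ (i%:R / 2 ^+ k), ((2 * i + 1)%:R / 2 ^+ k.+1) [) x
  - \1_(`[ ((2 * i + 1)%:R / 2 ^+ k.+1), (i.+1%:R / 2 ^+ k) [) x.

(* a family (h^n_I) : h n k i = h^n_I with I the i-th dyadic interval of
   length 2^-k; valid indices (= D_omega): n >= 1, k <= n-1, i < 2^k. *)
Definition Domega (j : nat * nat * nat) : bool :=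
  let: (n, k, i) := j in [&& (0 < n)%N, (k < n)%N & (i < 2 ^ k)%N].

(* each block (h^n_I)_{I in D_{n-1}} has the same joint distribution as
   (h_I)_{I in D_{n-1}} (equality of the laws on all measurable rectangles) *)
Definition same_joint_dist (h : nat -> nat -> nat -> R -> R) : Prop :=
  forall n : nat, (0 < n)%N ->
  forall B : nat -> nat -> set R, (forall k i, measurable (B k i)) ->
  mu01 (\bigcap_(k in [set k | (k < n)%N])
          \bigcap_(i in [set i | (i < 2 ^ k)%N]) (h n k i @^-1` B k i))
  = mu01 (\bigcap_(k in [set k | (k < n)%N])
          \bigcap_(i in [set i | (i < 2 ^ k)%N]) (haar k i @^-1` B k i)).

Definition gen_sigma (h : nat -> nat -> nat -> R -> R) (n : nat) : set (set R) :=
  smallest (sigma_algebra `[(0:R), 1])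
    [set A | exists k i (B : set R), [/\ (k < n)%N, (i < 2 ^ k)%N,
        measurable B & A = `[(0:R), 1] `&` (h n k i @^-1` B)]].

Definition indep_blocks (h : nat -> nat -> nat -> R -> R) : Prop :=
  forall s : seq nat, uniq s -> all (fun n => (0 < n)%N) s ->
  forall A : nat -> set R, (forall n, n \in s -> gen_sigma h n (A n)) ->
  mu01 (\bigcap_(n in [set` s]) A n) = (\prod_(n <- s) mu01 (A n))%E.

Definition in_span (h : nat -> nat -> nat -> R -> R) (g : R -> R) : Prop :=
  exists (s : seq (nat * nat * nat)) (c : nat * nat * nat -> R),
    all Domega s /\
    g = (fun x => \sum_(j <- s) c j * h j.1.1 j.1.2 j.2 x).

Definition RpO (h : nat -> nat -> nat -> R -> R) (p : R) (f : R -> R) : Prop :=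
  measurable_fun setT f /\
  forall e : R, 0 < e -> exists g, in_span h g /\ (pnorm p (fun x => (f x - g x)%R) < e%:E)%E.

Definition bdd_op (h : nat -> nat -> nat -> R -> R) (p : R)
    (T : (R -> R) -> (R -> R)) (C : R) : Prop :=
  [/\ forall f, RpO h p f -> RpO h p (T f),
      forall f g (a b : R), RpO h p f -> RpO h p g ->
        aeq (T (fun x => a * f x + b * g x)) (fun x => a * T f x + b * T g x)
    & forall f, RpO h p f -> (pnorm p (T f) <= C%:E * pnorm p f)%E].

Definition IminusOp (T : (R -> R) -> (R -> R)) : (R -> R) -> (R -> R) :=
  fun f x => f x - T f x.

Definition fact_const (p eps : R) : R :=
  4 / (1 - eps) * (pstar p - 1) ^+ 2 * powR (pstar p / 2) (3 / 2).

End Defs.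

(* Main.v *)
From mathcomp Require Import all_fingroup.
Require Import Defs.
From HB Require Import structures.
From mathcomp Require Import all_boot all_order all_algebra.
From mathcomp Require Import all_classical all_reals all_analysis.
From mathcomp Require Import measurable_realfun.
From mathcomp Require Import ring lra zify.

Set Implicit Arguments.
Unset Strict Implicit.
Unset Printing Implicit Defensive.

Import Order.TTheory GRing.Theory Num.Theory numFieldNormedType.Exports.
Local Open Scope classical_set_scope.
Local Open Scope ring_scope.

(* Cut [0,1] into the sets on which a block of the Haar family is constant: the
   block becomes a copy of the mean-zero functions on [2 ^ n.+1] equiprobable
   points, and different blocks are independent.  A map rho from the points of a
   large block onto those of the n-th one, with fibres of equal size, gives an
   isometric copy [v \o rho] of the n-th block, and averaging over the fibres is
   a left inverse; by Jensen's inequality one copy per block, taken in different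
   blocks, gives an isometry B and a contraction A with A B = I.
   Now cut the large block into many groups and permute each group by an
   independent uniform permutation before applying rho.  As the symmetric group
   is 2-transitive, the expected matrix of A T B on the copy is a scalar; the
   fluctuations, and the interaction with the copies already chosen, have a
   variance which tends to 0 with the number of groups.  Choosing the copies one
   after the other, along a sequence where the scalars converge to lambda, makes
   A T B - lambda I of norm at most 1/4.  One of |lambda|, |1 - lambda| is at
   least 1/2, and a Neumann series yields a factorization with constant 4, which
   is at most the required one. *)

(** * Bounded operators between Banach spaces *)

Lemma closure_le {R : realType} {T : topologicalType} (D : set T) (f g : T -> R) :
  continuous f -> continuous g -> (forall x, D x -> f x <= g x) ->
  forall x, closure D x -> f x <= g x.
Proof.
move=> fc gc Dfg x Dx; pose E := [set x | 0 <= g x - f x].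
have cle : closed E.
  apply: (@preimage_closed _ _ (g \- f) [set r | 0 <= r]); last exact: closed_ge.
  by move=> z _; apply: cvgB; [exact: gc|exact: fc].
suff : E x by rewrite /E /= subr_ge0.
rewrite ((closure_id E).1 cle); apply: closureS Dx => y /Dfg.
by rewrite /E /= subr_ge0.
Qed.

Definition op_bound {R : realType} {X Y : normedModType R} (F : X -> Y) (C : R) :=
  forall x, `|F x| <= C * `|x|.

Section BoundedOperators.
Context {R : realType} {X Y : normedModType R}.

Lemma op_bound_continuous (F : {linear X -> Y}) C : op_bound F C -> continuous F.
Proof.
move=> bF; apply/linear_bounded_continuous/linear_boundedP.
by near=> r => x; apply: le_trans (bF x) _; rewrite ler_wpM2r.
Unshelve. all: by end_near. Qed.

Lemma dense_le_norm (D : set X) (F : X -> Y) (c : R) : continuous F ->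
  closure D = setT -> (forall x, D x -> `|F x| <= c * `|x|) -> op_bound F c.
Proof.
move=> Fc DT FD x; apply: (closure_le _ _ FD); last by rewrite DT.
  by move=> y; apply: cvg_norm; exact: Fc.
by move=> y; apply: cvgMr; exact: norm_continuous.
Qed.

Lemma dense_ext (D : set X) (F G : X -> Y) : continuous F -> continuous G ->
  closure D = setT -> (forall x, D x -> F x = G x) -> F =1 G.
Proof.
move=> Fc Gc DT FG x; apply/eqP; rewrite -subr_eq0 -normr_le0.
rewrite -[leRHS](mul0r `|x|).
apply: (@dense_le_norm D (F \- G) 0 _ DT) => [z|y Dy].
  by apply: cvgB; [exact: Fc|exact: Gc].
by rewrite /= FG// subrr normr0 mul0r.
Qed.

End BoundedOperators.

Lemma neumann {R : realType} {X : completeNormedModType R} (E : {linear X -> X})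
    (q : R) : 0 <= q < 1 -> op_bound E q ->
  exists2 W : {linear X -> X}, op_bound W (1 - q)^-1 & forall x, W (x + E x) = x.
Proof.
move=> /andP[q0 q1] bE.
have q1' : 0 < 1 - q by rewrite subr_gt0.
have lower x : (1 - q) * `|x| <= `|x + E x|.
  have := lerB_normD x (E x); have := bE x; lra.
have inj x y : x + E x = y + E y -> x = y.
  move=> xy; apply/eqP; rewrite -subr_eq0 -normr_le0 -(pmulr_rle0 _ q1').
  apply: le_trans (lower _) _.
  by rewrite linearB/= addrACA -opprD xy subrr normr0.
have /choice[W WE] y : exists x, x + E x = y.
  pose ctr : X -> X := totalfun (fun x => y - E x).
  have ctrE : is_contraction (ctr : {fun [set: X] >-> [set: X]}).
    exists (NngNum q0); split => // -[a b] _ /=.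
    rewrite /ctr /totalfun_ addrC opprB addrA subrK -linearB/=.
    by rewrite [`|a - b|]distrC; exact: bE.
  have [|x _ xE] := banach_fixed_point ctrE closedT; first by exists 0.
  by exists x; rewrite {1}xE /ctr subrK.
have Wlin : linear W.
  move=> a x y; apply: inj; rewrite WE linearP/=.
  by rewrite addrACA -scalerDr !WE.
pose lW := GRing.isLinear.Build _ _ _ _ W Wlin.
pose LW : {linear X -> X} := HB.pack W lW.
exists LW => x; last by apply: inj; exact: WE.
by rewrite ler_pdivlMl// -[in leRHS](WE x); exact: lower.
Qed.

Section GraphExtension.
Context {R : realType} {X : normedModType R} {Y : completeNormedModType R}.
Variables (G : X -> Y -> Prop) (C : R).
Hypothesis C0 : 0 <= C.
Hypothesis G_linear : forall a x y x' y', G x y -> G x' y' ->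
  G (a *: x + x') (a *: y + y').
Hypothesis G_bound : forall x y, G x y -> `|y| <= C * `|x|.
Hypothesis G_dense : closure [set x | exists y, G x y] = setT.

Let closed_graph : set (X * Y) := closure [set xy | G xy.1 xy.2].

Let closed_graph_linear a x y x' y' : closed_graph (x, y) -> closed_graph (x', y') ->
  closed_graph (a *: x + x', a *: y + y').
Proof.
move=> clu clv B nB; set u := (x, y) in clu; set v := (x', y') in clv.
have /(_ B nB) [[U V] /= [Uu Vv] UVB] :
    (fun uv : (X * Y) * (X * Y) => a *: uv.1 + uv.2) @ (u, v) --> a *: u + v.
  by apply: cvgD; [apply: cvgZr; exact: cvg_fst|exact: cvg_snd].
have [z [/= Gz Uz]] := clu _ Uu; have [z' [/= Gz' Vz']] := clv _ Vv.
exists (a *: z + z'); split; first exact: G_linear.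
exact: (UVB (z, z')).
Qed.

Let closed_graph_bound x y : closed_graph (x, y) -> `|y| <= C * `|x|.
Proof.
apply: (closure_le (f := fun u : X * Y => `|u.2|) (g := fun u : X * Y => C * `|u.1|)).
- by move=> u; apply: cvg_norm; exact: cvg_snd.
- by move=> u; apply: cvgMr; apply: cvg_norm; exact: cvg_fst.
- by move=> u; exact: G_bound.
Qed.

Let image_near x (e : R) : set Y := [set y | exists2 x', ball x e x' & G x' y].

Let image_near_nonempty x e : 0 < e -> image_near x e !=set0.
Proof.
move=> e0; have : closure [set x | exists y, G x y] x by rewrite G_dense.
by move=> /(_ _ (nbhsx_ballx x e e0))[x' [[y Gxy] xx']]; exists y, x'.
Qed.

Let image_near_min x d e y : image_near x (Num.min d e) y ->
  image_near x d y /\ image_near x e y.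
Proof.
move=> [x' xx' Gxy]; split; exists x' => //; apply: le_ball xx'.
  by rewrite ge_min lexx.
by rewrite ge_min lexx orbT.
Qed.

Let image_filter x : set_system Y := filter_from [set e : R | 0 < e] (image_near x).

#[local] Instance image_filter_proper x : ProperFilter (image_filter x).
Proof.
apply: filter_from_proper; last by move=> e; exact: image_near_nonempty.
apply: filter_from_filter; first by exists 1; exact: ltr01.
move=> d e d0 e0; exists (Num.min d e); first by rewrite /= lt_min d0.
by move=> y /image_near_min.
Qed.

Let image_filter_cauchy x : cauchy (image_filter x).
Proof.
apply: cauchy_exP => e e0; have C1 : 0 < C + 1 by rewrite ltr_wpDl.
have d0 : 0 < e / 2 / (C + 1) by rewrite !divr_gt0.
have [y [x' xx' Gxy]] := image_near_nonempty x d0.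
exists y; exists (e / 2 / (C + 1)) => // z [w xw Gwz].
rewrite -ball_normE/=; have := G_bound (G_linear (-1) Gwz Gxy).
rewrite !scaleN1r ![- _ + _]addrC => /le_lt_trans; apply.
have xw' : `|x' - w| <= 2 * (e / 2 / (C + 1)).
  rewrite -(subrKA x); apply: le_trans (ler_normD _ _) _.
  move: xx' xw; rewrite -ball_normE/= [`|x - x'|]distrC; lra.
apply: le_lt_trans (ler_wpM2l C0 xw') _.
have -> : C * (2 * (e / 2 / (C + 1))) = e * (C / (C + 1)) by field; rewrite gt_eqF.
by rewrite gtr_pMr// ltr_pdivrMr// mul1r ltrDl.
Qed.

Let closed_graph_total x : exists y, closed_graph (x, y).
Proof.
exists (lim (image_filter x)) => B /= [[U V] /= [Ux Vy] UVB].
have : image_filter x V by have := cauchy_cvg _ (@image_filter_cauchy x); exact.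
case=> d d0 dV; move: Ux => /nbhs_ballP[d' /= d'0 d'U].
have [|y] := @image_near_nonempty x (Num.min d d'); first by rewrite lt_min d0.
move=> /[dup] /image_near_min[yd _] [x' xx' Gxy].
exists (x', y); split => //; apply: UVB; split => /=; last exact: dV.
by apply: d'U; apply: le_ball xx'; rewrite ge_min lexx orbT.
Qed.

Let closed_graph_unique x y y' : closed_graph (x, y) -> closed_graph (x, y') -> y = y'.
Proof.
move=> cy cy'; apply/eqP; rewrite -subr_eq0 -normr_le0.
have := closed_graph_bound (@closed_graph_linear (-1) _ _ _ _ cy' cy).
by rewrite !scaleN1r addNr normr0 mulr0 addrC.
Qed.

Lemma extend_graph : exists2 F : {linear X -> Y}, op_bound F C &
  forall x y, G x y -> F x = y.
Proof.
have [F FP] := choice closed_graph_total.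
have Flin : linear F.
  move=> a x x'; apply: closed_graph_unique (FP _) _.
  exact: (closed_graph_linear (FP x) (FP x')).
pose LF : {linear X -> Y} := HB.pack F (GRing.isLinear.Build _ _ _ _ F Flin).
exists LF => [x|x y Gxy]; first exact: (closed_graph_bound (FP x)).
by apply: closed_graph_unique (FP x) _; exact: (@subset_closure _ _ (x, y)).
Qed.

End GraphExtension.

(** * Banach spaces from complete seminorms *)

Lemma cvg_half_powers {R : realType} : 2^-1 ^+ k @[k --> \oo] --> (0 : R).
Proof. by apply: cvg_expr; rewrite ger0_norm; lra. Qed.

Lemma sum_half_powers_le {R : realType} M : \sum_(j < M) 2^-1 ^+ j <= 2 :> R.
Proof.
have h1 : `|2^-1 : R| < 1 by rewrite ger0_norm; lra.
have h0 : 0 < 2^-1 :> R by rewrite invr_gt0.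
have := geometric_le_lim M (@ler01 R) h0 h1.
rewrite seriesEord mul1r/=; under eq_bigr do rewrite mul1r.
by move/le_trans; apply; rewrite (_ : (1 - 2^-1)^-1 = 2 :> R)//; field.
Qed.

Lemma fast_cauchy_complete {R : realType} (X : normedModType R) :
  (forall x : nat -> X, (forall k, `|x k.+1 - x k| <= 2^-1 ^+ k) -> cvgn x) ->
  forall F : set_system X, ProperFilter F -> cauchy F -> cvg F.
Proof.
move=> fast F FF cF; pose r k : R := 2^-1 ^+ k.+2.
have r0 k : 0 < r k by rewrite exprn_gt0// invr_gt0.
have /choice[x xP] k : exists x, F (ball x (r k)).
  by have /cauchyP/(_ _ (r0 k)) := cF.
have /fast/cvg_ex[y xy] k : `|x k.+1 - x k| <= 2^-1 ^+ k.
  have [z [xz xz']] := filter_ex (filterI (xP k) (xP k.+1)).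
  move: xz xz'; rewrite -!ball_normE/= => xz xz'.
  rewrite -(subrKA z); apply: le_trans (ler_normD _ _) _.
  by move: (r0 k) xz xz'; rewrite [`|z - _|]distrC /r !exprS; lra.
apply/cvg_ex; exists y; apply/cvgrPdist_lt => e e0.
have e20 : 0 < e / 2 by rewrite divr_gt0.
have small_r : \forall k \near \oo, 2^-1 ^+ k < e / 2.
  have /cvgrPdist_lt/(_ _ e20) := @cvg_half_powers R; apply: filterS => k.
  by rewrite sub0r normrN ger0_norm// exprn_ge0// invr_ge0.
move/cvgrPdist_lt: xy => /(_ _ e20)/(filterI small_r)/filter_ex[k [rk yxk]].
apply: filterS (xP k) => z; rewrite -ball_normE/= => xz.
rewrite -(subrKA (x k)); apply: le_lt_trans (ler_normD _ _) _.
by have := r0 k; move: xz rk; rewrite /r !exprS; lra.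
Qed.

Record complete_seminorm {R : realType} (V : lmodType R) := CompleteSeminorm {
  seminorm :> V -> R;
  ler_seminormD : forall u v, seminorm (u + v) <= seminorm u + seminorm v;
  seminormZ : forall a v, seminorm (a *: v) = `|a| * seminorm v;
  seminorm_complete : forall v : nat -> V,
    (forall k, seminorm (v k.+1 - v k) <= 2^-1 ^+ k) ->
    exists w, seminorm (w - v k) @[k --> \oo] --> 0 }.

Section Submodule.
Context {R : pzRingType} {V : lmodType R} (W : submodClosed V).

Definition submodule : Type := {v : V | v \in W}.

HB.instance Definition _ := SubChoice.on submodule.
HB.instance Definition _ := [SubChoice_isSubLmodule of submodule by <:].

End Submodule.

Section SeminormedQuotient.
Context {R : realType} {V : lmodType R} (N : complete_seminorm V).
Implicit Types (u v : V).

Lemma seminorm0 : N 0 = 0.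
Proof. by rewrite -[X in N X](scale0r 0) seminormZ normr0 mul0r. Qed.

Lemma seminormN v : N (- v) = N v.
Proof. by rewrite -scaleN1r seminormZ normrN1 mul1r. Qed.

Lemma ler_seminormB u v : N u <= N v + N (u - v).
Proof. by rewrite -[X in N X <= _](subrKC v); exact: ler_seminormD. Qed.

Lemma seminorm_eq u v : N (u - v) = 0 -> N u = N v.
Proof.
move=> uv; apply/eqP; rewrite eq_le; apply/andP; split.
  by have := ler_seminormB u v; rewrite uv addr0.
by have := ler_seminormB v u; rewrite -[N (v - u)]seminormN opprB uv addr0.
Qed.

Definition null_vector : {pred V} := fun v => N v == 0.

Lemma null_vector_zmod_closed : zmod_closed null_vector.
Proof.
split=> [|u v /eqP u0 /eqP v0]; apply/eqP; first exact: seminorm0.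
by rewrite (seminorm_eq (v := u)) ?u0// addrC addKr seminormN.
Qed.

HB.instance Definition _ :=
  GRing.isZmodClosed.Build V null_vector null_vector_zmod_closed.

Definition normed_quotient : Type := {ideal_quot null_vector}.

HB.instance Definition _ := GRing.Zmodule.on normed_quotient.

Definition class v : normed_quotient := \pi_({ideal_quot null_vector})%qT v.

Definition representative (x : normed_quotient) : V := repr x.

Implicit Types x y : normed_quotient.

Lemma representativeK : cancel representative class.
Proof. exact: reprK. Qed.

Lemma class_eqP u v : class u = class v <-> N (u - v) = 0.
Proof.
split=> [/eqP|uv]; first by rewrite -Quotient.idealrBE => /eqP.
by apply/eqP; rewrite -Quotient.idealrBE; apply/eqP.
Qed.

Lemma classB : {morph class : u v / u - v}.
Proof. exact: pi_is_zmod_morphism. Qed.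

HB.instance Definition _ := GRing.isZmodMorphism.Build V normed_quotient class classB.

Definition scale_class (a : R) x := class (a *: representative x).

Lemma classZ a v : class (a *: v) = scale_class a (class v).
Proof.
apply/class_eqP; rewrite -scalerBr seminormZ.
have /class_eqP := representativeK (class v).
by rewrite -seminormN opprB => ->; rewrite mulr0.
Qed.

Lemma scale_classA a b x : scale_class a (scale_class b x) = scale_class (a * b) x.
Proof. by rewrite -[x]representativeK -!classZ scalerA. Qed.

Lemma scale_class1 : left_id 1 scale_class.
Proof. by move=> x; rewrite /scale_class scale1r representativeK. Qed.

Lemma scale_classDr : right_distributive scale_class +%R.
Proof.
move=> a x y; rewrite -[x]representativeK -[y]representativeK -raddfD -!classZ.
by rewrite scalerDr raddfD.
Qed.

Lemma scale_classDl x : {morph scale_class^~ x : a b / a + b}.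
Proof. by move=> a b; rewrite /scale_class scalerDl raddfD. Qed.

HB.instance Definition _ := GRing.Zmodule_isLmodule.Build R normed_quotient
  scale_classA scale_class1 scale_classDr scale_classDl.

HB.instance Definition _ :=
  GRing.isScalable.Build R V normed_quotient *:%R class classZ.

Definition class_norm x : R := N (representative x).

Lemma class_norm_class v : class_norm (class v) = N v.
Proof. by apply: seminorm_eq; apply/class_eqP; exact: representativeK. Qed.

Lemma ler_class_normD x y : class_norm (x + y) <= class_norm x + class_norm y.
Proof.
rewrite -[x]representativeK -[y]representativeK -raddfD !class_norm_class.
exact: ler_seminormD.
Qed.

Lemma class_normZ a x : class_norm (a *: x) = `|a| * class_norm x.
Proof.
by rewrite -[x]representativeK -linearZ !class_norm_class seminormZ.
Qed.

Lemma class_norm0_eq0 x : class_norm x = 0 -> x = 0.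
Proof.
rewrite -[x]representativeK class_norm_class -(raddf0 class) => x0.
by apply/class_eqP; rewrite subr0.
Qed.

HB.instance Definition _ := Lmodule_isNormed.Build R normed_quotient
  ler_class_normD class_normZ class_norm0_eq0.

Lemma norm_class v : `|class v| = N v.
Proof. exact: class_norm_class. Qed.

Lemma normed_quotient_fast_cvg (x : nat -> normed_quotient) :
  (forall k, `|x k.+1 - x k| <= 2^-1 ^+ k) -> cvgn x.
Proof.
move=> fast; have [|w wx] := seminorm_complete (c := N) (v := representative \o x).
  move=> k; rewrite -norm_class classB !representativeK; exact: fast.
apply/cvg_ex; exists (class w); apply/cvgrPdist_lt => e e0.
move/cvgrPdist_lt: wx => /(_ _ e0); apply: filterS => k.
by rewrite sub0r normrN -norm_class normr_id classB/= representativeK.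
Qed.

HB.instance Definition _ := Uniform_isComplete.Build normed_quotient
  (fast_cauchy_complete normed_quotient_fast_cvg).

End SeminormedQuotient.

(** * Averages and sums of independent variables *)

Section Average.
Context {R : realType}.
Implicit Types (T U : finType) (phi : R -> R).

Definition avg T (f : T -> R) : R := #|T|%:R^-1 * \sum_x f x.

Definition mean_zero T (f : T -> R) : Prop := \sum_x f x = 0.

Lemma eq_avg T (f g : T -> R) : f =1 g -> avg f = avg g.
Proof. by move=> fg; congr (_ * _); apply: eq_bigr. Qed.

Lemma le_avg T (f g : T -> R) : (forall x, f x <= g x) -> avg f <= avg g.
Proof. by move=> fg; rewrite ler_wpM2l ?invr_ge0// ler_sum. Qed.

Lemma avg_cst T (c : R) : (0 < #|T|)%N -> avg (fun _ : T => c) = c.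
Proof.
move=> T0; rewrite /avg sumr_const -[c *+ _]mulr_natl mulKf//.
by rewrite pnatr_eq0 -lt0n.
Qed.

Lemma avg_eq_cst T (f : T -> R) c : (0 < #|T|)%N -> (forall x, f x = c) -> avg f = c.
Proof. by move=> T0 /eq_avg ->; exact: avg_cst. Qed.

Lemma avg_le_cst T (f : T -> R) c : (0 < #|T|)%N -> (forall x, f x <= c) -> avg f <= c.
Proof. by move=> T0 /le_avg; rewrite avg_cst. Qed.

Lemma avgD T (f g : T -> R) : avg (fun x => f x + g x) = avg f + avg g.
Proof. by rewrite /avg big_split/= mulrDr. Qed.

Lemma avgZ T c (f : T -> R) : avg (fun x => c * f x) = c * avg f.
Proof. by rewrite /avg -mulr_sumr mulrCA. Qed.

Lemma avg_sum T (I : Type) (r : seq I) (P : pred I) (f : I -> T -> R) :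
  avg (fun x => \sum_(i <- r | P i) f i x) = \sum_(i <- r | P i) avg (f i).
Proof. by rewrite /avg exchange_big/= mulr_sumr. Qed.

Lemma avg_ge0 T (f : T -> R) : (forall x, 0 <= f x) -> 0 <= avg f.
Proof. by move=> f0; rewrite mulr_ge0 ?invr_ge0// sumr_ge0. Qed.

Lemma avg_mean_zero T (f : T -> R) : mean_zero f -> avg f = 0.
Proof. by rewrite /avg => ->; rewrite mulr0. Qed.

Lemma ler_norm_avg T (f : T -> R) : `|avg f| <= avg (fun x => `|f x|).
Proof.
by rewrite normrM ger0_norm ?invr_ge0// ler_wpM2l ?invr_ge0// ler_norm_sum.
Qed.

Lemma mean_zero_lin T a (f g : T -> R) : mean_zero f -> mean_zero g ->
  mean_zero (a *: f + g).
Proof. by rewrite /mean_zero big_split/= -mulr_sumr => -> ->; rewrite mulr0 addr0. Qed.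

Lemma mean_zero0 T : mean_zero (0 : T -> R).
Proof. by rewrite /mean_zero big1. Qed.

Definition subdifferentiable phi : Prop :=
  forall t0, exists s, forall t, phi t0 + s * (t - t0) <= phi t.

Lemma subdifferentiable_shift phi x : subdifferentiable phi ->
  subdifferentiable (fun t => phi (t + x)).
Proof.
move=> sphi t0; have [s hs] := sphi (t0 + x); exists s => t.
by apply: le_trans (hs (t + x)); rewrite lerD2l opprD addrACA subrr addr0.
Qed.

Lemma subdifferentiable_avg T (phi : T -> R -> R) :
  (forall x, subdifferentiable (phi x)) -> subdifferentiable (fun t => avg (phi^~ t)).
Proof.
move=> sphi t0; have /choice[s hs] := fun x => sphi x t0.
exists (avg s) => t; rewrite mulrC -avgZ -avgD; apply: le_avg => x.
by apply: le_trans (hs x t); rewrite lerD2l mulrC.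
Qed.

Lemma subdifferentiable_powR (p : R) : 1 < p -> subdifferentiable (fun t => `|t| `^ p).
Proof.
move=> p1 t0; have p0 : 0 < p by exact: lt_trans p1.
have p0' : p != 0 by rewrite gt_eqF.
exists (p * `|t0| `^ (p - 1) * Num.sg t0) => t.
have young : p * (`|t0| `^ (p - 1) * `|t|) <= (p - 1) * `|t0| `^ p + `|t| `^ p.
  have q0 : 0 < p / (p - 1) by rewrite divr_gt0// subr_gt0.
  have pq : (p / (p - 1))^-1 + p^-1 = 1 by rewrite invf_div; field.
  have := conjugate_powR (powR_ge0 `|t0| (p - 1)) (normr_ge0 t) q0 p0 pq.
  rewrite -powRrM (_ : (p - 1) * (p / (p - 1)) = p); last by field; lra.
  rewrite invf_div -(ler_pM2l p0) => /le_trans; apply.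
  by rewrite le_eqVlt; apply/orP; left; apply/eqP; field.
have tangent : `|t0| `^ (p - 1) * (Num.sg t0 * t0) = `|t0| `^ p.
  by rewrite -normrEsg mulrC mulr_powRB1.
have sgt : Num.sg t0 * t <= `|t|.
  apply: le_trans (ler_norm _) _; rewrite normrM ler_piMl// normr_sg.
  by case: eqP.
have := ler_wpM2l (powR_ge0 `|t0| (p - 1)) sgt; rewrite -(ler_pM2l p0).
rewrite -tangent in young *; lra.
Qed.

End Average.

Section Fibres.
Context {R : realType} {T U : finType}.
Variable rho : T -> U.
Implicit Types (f : T -> R) (v : U -> R).

Definition equidistributed : Prop :=
  forall u, (#|[pred x | rho x == u]| * #|U| = #|T|)%N.

Definition cond_exp f (u : U) : R :=
  #|U|%:R / #|T|%:R * \sum_(x | rho x == u) f x.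

Lemma sum_fibres f : \sum_u \sum_(x | rho x == u) f x = \sum_x f x.
Proof. by rewrite [RHS](partition_big rho xpredT). Qed.

Lemma cond_exp_lin a f g :
  cond_exp (a *: f + g) = a *: cond_exp f + cond_exp g.
Proof.
by apply/funext => u; rewrite /cond_exp big_split/= -mulr_sumr mulrDr mulrCA.
Qed.

Lemma cond_exp_mean_zero f : mean_zero f -> mean_zero (cond_exp f).
Proof.
by rewrite /mean_zero -mulr_sumr sum_fibres => ->; rewrite mulr0.
Qed.

Hypothesis rho_eq : equidistributed.
Hypothesis T0 : (0 < #|T|)%N.

Let T0' : #|T|%:R != 0 :> R. Proof. by rewrite pnatr_eq0 -lt0n. Qed.

Let U0 : (0 < #|U|)%N.
Proof. by have /card_gt0P[x _] := T0; apply/card_gt0P; exists (rho x). Qed.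

Let U0' : #|U|%:R != 0 :> R. Proof. by rewrite pnatr_eq0 -lt0n. Qed.

Lemma sum_fibre_cst u (c : R) : \sum_(x | rho x == u) c = #|T|%:R / #|U|%:R * c.
Proof.
by rewrite sumr_const -[LHS]mulr_natl -(rho_eq u) natrM mulfK.
Qed.

Lemma cond_exp_comp v : cond_exp (v \o rho) = v.
Proof.
apply/funext => u; rewrite /cond_exp.
rewrite (eq_bigr (fun=> v u)); last by move=> x /eqP <-.
rewrite sum_fibre_cst; field; exact/andP.
Qed.

Lemma avg_cond_exp f : avg (cond_exp f) = avg f.
Proof.
rewrite /avg -mulr_sumr sum_fibres.
by field; rewrite T0'.
Qed.

Lemma avg_comp v : avg (v \o rho) = avg v.
Proof. by rewrite -avg_cond_exp cond_exp_comp. Qed.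

Lemma mean_zero_comp v : mean_zero v -> mean_zero (v \o rho).
Proof.
move=> v0; have /eqP := avg_comp v; rewrite (avg_mean_zero v0) /avg mulf_eq0.
by rewrite invr_eq0 (negbTE T0') => /eqP.
Qed.

Lemma jensen_cond_exp phi f : subdifferentiable phi ->
  avg (phi \o cond_exp f) <= avg (phi \o f).
Proof.
move=> sphi; have /choice[s hs] := fun u => sphi (cond_exp f u).
rewrite -[leRHS]avg_cond_exp; apply: le_avg => u /=.
rewrite [leRHS]/cond_exp -ler_pdivrMl ?divr_gt0 ?ltr0n// invf_div.
apply: (@le_trans _ _ (\sum_(x | rho x == u)
    (phi (cond_exp f u) + s u * (f x - cond_exp f u)))); last exact: ler_sum.
rewrite big_split/= sum_fibre_cst -mulr_sumr sumrB sum_fibre_cst.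
have -> : \sum_(x | rho x == u) f x = #|T|%:R / #|U|%:R * cond_exp f u.
  by rewrite /cond_exp; field; rewrite T0'.
by rewrite subrr mulr0 addr0.
Qed.

End Fibres.

Lemma jensen_avg {R : realType} (T : finType) (phi : R -> R) (f : T -> R) :
  (0 < #|T|)%N -> subdifferentiable phi -> phi (avg f) <= avg (phi \o f).
Proof.
move=> T0 sphi; pose rho (x : T) := tt.
have rho_eq : equidistributed rho.
  by case; rewrite card_unit muln1; apply: eq_card => x; rewrite !inE.
apply: le_trans (jensen_cond_exp rho_eq T0 f sphi).
rewrite /avg card_unit invr1 mul1r (big_pred1 tt); last by case.
by rewrite /= /cond_exp card_unit mul1r.
Qed.

(* [indep_mean phi s t] is the expectation of [phi (t + \sum_(i <- s) f i (w i))]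
   for independent [w i] uniform in [Om i]. *)
Section IndependentSums.
Context {R : realType}.
Implicit Types (Om : nat -> finType) (s : seq nat) (t : R).

Fixpoint indep_mean (phi : R -> R) (Om : nat -> finType) (f : forall i, Om i -> R)
    s t : R :=
  if s is i :: s' then avg (fun x => indep_mean phi f s' (t + f i x)) else phi t.

Variable phi : R -> R.

Lemma indep_mean_map Om (f : forall i, Om i -> R) (N : nat -> nat) s t :
  indep_mean phi f [seq N j | j <- s] t = indep_mean phi (fun j => f (N j)) s t.
Proof. by elim: s t => //= j s IH t; apply: eq_avg => x. Qed.

Lemma indep_mean_copy Om (Om' : nat -> finType) (f : forall i, Om i -> R)
    (rho : forall i, Om' i -> Om i) s t :
  (forall i, (0 < #|Om' i|)%N) -> (forall i, equidistributed (rho i)) ->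
  indep_mean phi (fun i => f i \o rho i) s t = indep_mean phi f s t.
Proof.
move=> Om0 rho_eq; elim: s t => //= i s IH t.
rewrite -[RHS](avg_comp (rho_eq i) (Om0 i)).
by apply: eq_avg => x; exact: IH.
Qed.

Hypothesis phi_sub : subdifferentiable phi.

Lemma subdifferentiable_indep_mean Om (f : forall i, Om i -> R) s :
  subdifferentiable (indep_mean phi f s).
Proof.
elim: s => //= i s IH; apply: subdifferentiable_avg => x.
exact: subdifferentiable_shift.
Qed.

Lemma indep_mean_cond_exp Om (Om' : nat -> finType) (f : forall i, Om' i -> R)
    (rho : forall i, Om' i -> Om i) s t :
  (forall i, (0 < #|Om' i|)%N) -> (forall i, equidistributed (rho i)) ->
  indep_mean phi (fun i => cond_exp (rho i) (f i)) s t <= indep_mean phi f s t.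
Proof.
move=> Om0 rho_eq; elim: s t => //= i s IH t.
apply: (@le_trans _ _ (avg (fun u => indep_mean phi f s (t + cond_exp (rho i) (f i) u)))).
  by apply: le_avg => u; exact: IH.
under eq_avg do rewrite addrC; under [leRHS]eq_avg do rewrite addrC.
apply: (jensen_cond_exp (rho_eq i) (Om0 i) (phi := fun r => indep_mean phi f s (r + t))).
exact/subdifferentiable_shift/subdifferentiable_indep_mean.
Qed.

Lemma indep_mean_filter Om (f : forall i, Om i -> R) (P : pred nat) s t :
  (forall i, (0 < #|Om i|)%N) -> (forall i, mean_zero (f i)) ->
  indep_mean phi f [seq i <- s | P i] t <= indep_mean phi f s t.
Proof.
move=> Om0 f0; elim: s t => //= i s IH t; case: (P i) => /=.
  by apply: le_avg => x; exact: IH.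
apply: le_trans (IH t) _.
have := jensen_avg (f i) (Om0 i) (subdifferentiable_shift t
  (subdifferentiable_indep_mean f s)).
rewrite (avg_mean_zero (f0 i)) add0r => /le_trans; apply.
by apply: le_avg => x; rewrite /= addrC.
Qed.

End IndependentSums.

(** * Second moments of random sums *)

Section SecondMoments.
Context {R : realType} {T : finType}.
Implicit Types f : T -> R.

Lemma avg_inj_comp f (h : T -> T) : injective h -> avg (f \o h) = avg f.
Proof. by move=> hinj; rewrite /avg [in RHS](reindex_inj hinj). Qed.

Lemma variance_le f : avg (fun x => (f x - avg f) ^+ 2) <= avg (fun x => f x ^+ 2).
Proof.
have [T0|T0] := posnP #|T|; first by rewrite {1 3}/avg T0 invr0 !mul0r.
rewrite (eq_avg (g := fun x => f x ^+ 2 + (- (2 * avg f) * f x + avg f ^+ 2)));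
  last by move=> x; ring.
rewrite avgD avgD avgZ avg_cst//.
have -> : - (2 * avg f) * avg f + avg f ^+ 2 = - avg f ^+ 2 by ring.
by rewrite gerBl sqr_ge0.
Qed.

Lemma exists_all_small (I : finType) (W : I -> T -> R) (Y e : R) : 0 < e ->
  (0 < #|T|)%N -> (forall i, avg (fun x => W i x ^+ 2) <= Y) ->
  #|I|%:R * Y < e ^+ 2 -> exists x, forall i, `|W i x| <= e.
Proof.
move=> e0 T0 WY IY; apply: contrapT => nosmall.
have large x : e ^+ 2 <= \sum_i W i x ^+ 2.
  have [i hi] : exists i, e < `|W i x|.
    apply: contrapT => small; apply: nosmall; exists x => i.
    by rewrite leNgt; apply/negP => hi; apply: small; exists i.
  rewrite (bigD1 i)//=; apply: (@le_trans _ _ (W i x ^+ 2)).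
    by rewrite -[leRHS]real_normK ?num_real// lerXn2r ?nnegrE// ltW.
  by rewrite lerDl sumr_ge0// => j _; exact: sqr_ge0.
have := le_avg large; rewrite avg_cst// avg_sum leNgt => /negP; apply.
apply: le_lt_trans IY; rewrite mulr_natl -sumr_const.
by apply: ler_sum => i _; exact: WY.
Qed.

Lemma avg_sqr_almost_orthogonal (E : finType) (sw : E -> E) (A : pred E)
    (x : E -> T -> R) : involutive sw -> (forall e, A (sw e) = A e) ->
  (forall e e', A e -> A e' -> e' != e -> e' != sw e ->
    avg (fun t => x e t * x e' t) = 0) ->
  avg (fun t => (\sum_(e | A e) x e t) ^+ 2) <=
  2 * \sum_(e | A e) avg (fun t => x e t ^+ 2).
Proof.
move=> swK Asw orth; pose m e := avg (fun t => x e t ^+ 2).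
have m_ge0 e : 0 <= m e by apply: avg_ge0 => t; exact: sqr_ge0.
have cross e e' : avg (fun t => x e t * x e' t) <= (m e + m e') / 2.
  rewrite mulrC -avgD -avgZ; apply: le_avg => t.
  by have := sqr_ge0 (x e t - x e' t); rewrite !expr2; lra.
have row e : A e -> \sum_(e' | A e') avg (fun t => x e t * x e' t) <=
    m e + (m e + m (sw e)) / 2.
  move=> Ae; rewrite (bigD1 e)//= lerD//.
  have [swe|swe] := eqVneq (sw e) e.
    rewrite big1 ?divr_ge0 ?addr_ge0// => e' /andP[Ae' ee'].
    by apply: orth; rewrite ?swe.
  rewrite (bigD1 (sw e))/=; last by rewrite Asw Ae.
  rewrite big1 ?addr0// => e' /andP[/andP[? ?] ?]; exact: orth.
have -> : avg (fun t => (\sum_(e | A e) x e t) ^+ 2) =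
    \sum_(e | A e) \sum_(e' | A e') avg (fun t => x e t * x e' t).
  under eq_avg do rewrite expr2 mulr_suml.
  rewrite avg_sum; apply: eq_bigr => e _.
  by under eq_avg do rewrite mulr_sumr; rewrite avg_sum.
apply: le_trans (ler_sum _ row) _.
rewrite big_split/= -mulr_suml big_split/=.
have -> : \sum_(e | A e) m (sw e) = \sum_(e | A e) m e.
  by rewrite [RHS](reindex_inj (inv_inj swK)); apply: eq_bigl => e; rewrite Asw.
by rewrite /m; lra.
Qed.

End SecondMoments.

Section RandomPermutations.
Context {R : realType} {K L : finType}.

Local Notation perms := {perm L}.
Local Notation sample := {ffun K -> {perm L}}.
Implicit Types (g : sample) (v w : L -> R).

Lemma card_perms_gt0 : (0 < #|{: perms}|)%N.
Proof. by apply/card_gt0P; exists 1%g. Qed.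

Lemma card_sample_gt0 : (0 < #|{: sample}|)%N.
Proof. by apply/card_gt0P; exists [ffun=> 1%g]. Qed.

Definition resample g k (sg : perms) : sample :=
  [ffun i => if i == k then sg else g i].

Lemma resampleE g k sg : resample g k sg k = sg.
Proof. by rewrite ffunE eqxx. Qed.

Lemma resample_neq g k sg l : l != k -> resample g k sg l = g l.
Proof. by rewrite ffunE => /negbTE ->. Qed.

Lemma avg_resample k (F : sample -> R) :
  avg F = avg (fun g => avg (fun sg => F (resample g k sg))).
Proof.
pose h sg g := resample g k (sg * g k)%g.
have hinj sg : injective (h sg).
  move=> g g' /ffunP gg; apply/ffunP => i; have := gg i; rewrite !ffunE.
  by case: eqP => [-> /mulgI|].
rewrite -[LHS](avg_cst _ card_perms_gt0).
transitivity (avg (fun sg => avg (fun g => F (h sg g)))).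
  by apply: eq_avg => sg; rewrite -(avg_inj_comp F (hinj sg)).
rewrite {1}/avg -avg_sum -avgZ; apply: eq_avg => g.
exact: (avg_inj_comp (fun sg => F (resample g k sg)) (mulIg (g k))).
Qed.

Lemma avg_sqr_independent (y : K -> perms -> R) :
  (forall k, avg (y k) = 0) ->
  avg (fun g : sample => (\sum_k y k (g k)) ^+ 2) =
  avg (fun g : sample => \sum_k y k (g k) ^+ 2).
Proof.
move=> y0; rewrite [RHS]avg_sum.
under eq_avg do rewrite expr2 mulr_suml.
rewrite avg_sum; apply: eq_bigr => k _.
under eq_avg do rewrite mulr_sumr.
rewrite avg_sum (bigD1 k)//= big1 ?addr0// => l lk.
rewrite (avg_resample l); apply: avg_eq_cst card_sample_gt0 _ => g.
under eq_avg do rewrite resampleE resample_neq 1?eq_sym//.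
by rewrite avgZ y0 mulr0.
Qed.

(* The pairs [(k, l)] and [(l, k)] involve the same permutations, hence the factor 2. *)
Lemma avg_sqr_degenerate (z : K -> K -> perms -> perms -> R) :
  (forall k l tau, avg (fun sg => z k l sg tau) = 0) ->
  (forall k l sg, avg (z k l sg) = 0) ->
  avg (fun g : sample => (\sum_k \sum_(l | l != k) z k l (g k) (g l)) ^+ 2) <=
  2 * avg (fun g : sample => \sum_k \sum_(l | l != k) z k l (g k) (g l) ^+ 2).
Proof.
move=> z1 z2; pose x (e : K * K) (g : sample) := z e.1 e.2 (g e.1) (g e.2).
pose off (e : K * K) := e.2 != e.1.
under eq_avg do rewrite pair_big_dep/=.
under [in leRHS]eq_avg do rewrite pair_big_dep/=.
rewrite [in leRHS]avg_sum.
apply: (avg_sqr_almost_orthogonal (sw := fun e => (e.2, e.1)) (A := off) (x := x)).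
- by case.
- by case=> k l; rewrite /off eq_sym.
move=> [k l] [k' l']; rewrite /off /= => lk lk' ne nsw.
have [/andP[k'k l'k]|] := boolP ((k' != k) && (l' != k)).
  rewrite (avg_resample k); apply: avg_eq_cst card_sample_gt0 _ => g.
  rewrite /x /= -[RHS](mulr0 (z k' l' (g k') (g l'))) -(z1 k l (g l)) -avgZ.
  by apply: eq_avg => sg; rewrite resampleE !resample_neq// mulrC.
rewrite negb_and !negbK => k_shared.
have /andP[k'l l'l] : (k' != l) && (l' != l).
  apply/andP; split; apply/eqP => l_shared; move: k_shared ne nsw lk' lk.
    by rewrite l_shared => /orP[/eqP->|/eqP->]; rewrite ?eqxx.
  by rewrite l_shared => /orP[/eqP->|/eqP->]; rewrite ?eqxx.
rewrite (avg_resample l); apply: avg_eq_cst card_sample_gt0 _ => g.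
rewrite /x /= -[RHS](mulr0 (z k' l' (g k') (g l'))) -(z2 k l (g k)) -avgZ.
by apply: eq_avg => sg; rewrite resampleE !resample_neq// 1?eq_sym// mulrC.
Qed.

Lemma avg_perm v c : avg (fun sg : perms => v (sg c)) = avg v.
Proof.
have L0 : (0 < #|L|)%N by apply/card_gt0P; exists c.
have move_to d : avg (fun sg : perms => v (sg c)) = avg (fun sg : perms => v (sg d)).
  rewrite -(avg_inj_comp _ (mulgI (tperm c d))).
  by apply: eq_avg => sg; rewrite /= permM tpermL.
rewrite -[LHS](avg_cst _ L0); under eq_avg => d do rewrite (move_to d).
rewrite {1}/avg -avg_sum -avgZ; apply: avg_eq_cst card_perms_gt0 _ => sg.
exact: (avg_inj_comp v (@perm_inj _ sg)).
Qed.

Lemma avg_sqr_linear_perm v (psi : K -> L -> R) (Y : R) : avg v = 0 ->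
  (forall g, \sum_k (\sum_c psi k c * v (g k c)) ^+ 2 <= Y) ->
  avg (fun g : sample => (\sum_k \sum_c psi k c * v (g k c)) ^+ 2) <= Y.
Proof.
move=> v0 psiY.
rewrite (avg_sqr_independent (y := fun k sg => \sum_c psi k c * v (sg c))).
  exact: avg_le_cst card_sample_gt0 _.
move=> k; rewrite avg_sum big1// => c _.
by rewrite avgZ avg_perm v0 mulr0.
Qed.

End RandomPermutations.

Section BilinearForms.
Context {R : realType} {K L : finType}.
Hypothesis L1 : (1 < #|L|)%N.

Local Notation perms := {perm L}.
Local Notation sample := {ffun K -> {perm L}}.
Implicit Types (g : sample) (v w : L -> R).

(* The symmetric group is 2-transitive, so a bilinear form averaged over it is
   a multiple of the inner product on mean-zero vectors. *)
Definition scalar_part (b : L -> L -> R) : R :=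
  \sum_c b c c - (#|L|.-1)%:R^-1 * \sum_c \sum_(d | d != c) b c d.

Lemma avg_perm_offdiag w v c d : mean_zero v -> d != c ->
  avg (fun sg : perms => w (sg c) * v (sg d)) =
  - ((#|L|.-1)%:R^-1 * avg (fun x => w x * v x)).
Proof.
move=> v0 dc; pose m e := avg (fun sg : perms => w (sg c) * v (sg e)).
have move_to e : e != c -> m e = m d.
  move=> ec; rewrite /m -(avg_inj_comp _ (mulgI (tperm d e))).
  by apply: eq_avg => sg /=; rewrite !permM tpermR tpermD// eq_sym.
have sum0 : \sum_e m e = 0.
  rewrite -avg_sum; apply: avg_eq_cst card_perms_gt0 _ => sg.
  by rewrite -mulr_sumr -(reindex_inj (P := xpredT) (F := v) (@perm_inj _ sg)) v0 mulr0.
have L1' : #|L|.-1%:R != 0 :> R by rewrite pnatr_eq0 -lt0n -subn1 subn_gt0.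
apply: (mulfI L1'); rewrite mulrN mulVKf// -(avg_perm (fun x => w x * v x) c).
move: sum0; rewrite -/(m c) -/(m d) (bigD1 c)//= => /eqP; rewrite addr_eq0 => /eqP ->.
rewrite opprK (eq_bigr (fun=> m d)) ?sumr_const ?mulr_natl//.
by congr (_ *+ _); have := cardC1 c; rewrite -/(pred _); move=> <-.
Qed.

Lemma avg_perm_bilinear (b : L -> L -> R) w v : mean_zero v ->
  avg (fun sg : perms => \sum_c \sum_d b c d * (w (sg c) * v (sg d))) =
  scalar_part b * avg (fun x => w x * v x).
Proof.
move=> v0; set ip := avg (fun x => _).
rewrite avg_sum; under eq_bigr => c _.
  rewrite avg_sum (bigD1 c)//= avgZ (avg_perm (fun x => w x * v x)).
  under eq_bigr => d dc do rewrite avgZ (avg_perm_offdiag w v0 dc).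
  rewrite -mulr_suml; over.
rewrite big_split/= -!mulr_suml /scalar_part mulrBl mulrN; congr (_ - _).
by rewrite mulrA; congr (_ * _); rewrite mulrC.
Qed.

Variable theta : K -> L -> K -> L -> R.

Definition block_form w v k l (sg tau : perms) : R :=
  \sum_c \sum_d theta k c l d * (w (sg c) * v (tau d)).

Definition mean_scalar : R := \sum_k scalar_part (fun c d => theta k c k d).

Lemma avg_diag_block_form w v : mean_zero v ->
  \sum_k avg (fun sg => block_form w v k k sg sg) =
  mean_scalar * avg (fun x => w x * v x).
Proof.
move=> v0; rewrite mulr_suml; apply: eq_bigr => k _.
exact: (avg_perm_bilinear (fun c d => theta k c k d)).
Qed.

Lemma variance_diag_block_form w v : mean_zero v ->
  avg (fun g => (\sum_k block_form w v k k (g k) (g k)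
      - mean_scalar * avg (fun x => w x * v x)) ^+ 2) <=
  avg (fun g => \sum_k block_form w v k k (g k) (g k) ^+ 2).
Proof.
move=> v0; rewrite -(avg_diag_block_form w v0).
pose f k (sg : perms) := block_form w v k k sg sg.
have centred k : avg (fun sg => f k sg - avg (f k)) = 0.
  by rewrite avgD avg_cst ?subrr// card_perms_gt0.
under eq_avg do rewrite -sumrB.
rewrite (avg_sqr_independent centred) !avg_sum; apply: ler_sum => k _.
rewrite (avg_resample k) [leRHS](avg_resample k); apply: le_avg => g.
under eq_avg do rewrite resampleE.
under [leRHS]eq_avg do rewrite resampleE.
exact: variance_le.
Qed.

Lemma avg_sqr_offdiag_block_form w v : mean_zero w -> mean_zero v ->
  avg (fun g => (\sum_k \sum_(l | l != k) block_form w v k l (g k) (g l)) ^+ 2) <=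
  2 * avg (fun g => \sum_k \sum_(l | l != k) block_form w v k l (g k) (g l) ^+ 2).
Proof.
move=> /avg_mean_zero w0 /avg_mean_zero v0; apply: avg_sqr_degenerate.
  move=> k l tau; rewrite /block_form avg_sum big1// => c _.
  rewrite avg_sum big1// => d _; rewrite avgZ.
  under eq_avg do rewrite mulrC; by rewrite avgZ avg_perm w0 !mulr0.
move=> k l sg; rewrite /block_form avg_sum big1// => c _.
by rewrite avg_sum big1// => d _; rewrite avgZ avgZ avg_perm v0 !mulr0.
Qed.

Lemma variance_block_form w v (Y : R) : mean_zero w -> mean_zero v ->
  (forall g, \sum_k \sum_l block_form w v k l (g k) (g l) ^+ 2 <= Y) ->
  avg (fun g => (\sum_k \sum_l block_form w v k l (g k) (g l)
      - mean_scalar * avg (fun x => w x * v x)) ^+ 2) <= 6 * Y.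
Proof.
move=> w0 v0 formY; set c := mean_scalar * _.
pose diag g := \sum_k block_form w v k k (g k) (g k) - c.
pose off g := \sum_k \sum_(l | l != k) block_form w v k l (g k) (g l).
have split g : \sum_k \sum_l block_form w v k l (g k) (g l) - c = diag g + off g.
  rewrite /diag /off addrAC -big_split/=; congr (_ - _); apply: eq_bigr => k _.
  by rewrite (bigD1 k).
have diagY : avg (fun g => diag g ^+ 2) <= Y.
  apply: le_trans (variance_diag_block_form w v0) _.
  apply: avg_le_cst card_sample_gt0 _ => g.
  apply: le_trans (formY g); apply: ler_sum => k _.
  by rewrite (bigD1 k)//= lerDl sumr_ge0// => l _; exact: sqr_ge0.
have offY : avg (fun g => off g ^+ 2) <= 2 * Y.
  apply: le_trans (avg_sqr_offdiag_block_form w0 v0) _.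
  rewrite ler_wpM2l//; apply: avg_le_cst card_sample_gt0 _ => g.
  apply: le_trans (formY g); apply: ler_sum => k _.
  by rewrite [leRHS](bigD1 k)//= lerDr sqr_ge0.
apply: (@le_trans _ _ (avg (fun g => 2 * diag g ^+ 2 + 2 * off g ^+ 2))).
  apply: le_avg => g; rewrite split.
  by have := sqr_ge0 (diag g - off g); rewrite !expr2; lra.
rewrite avgD !avgZ; lra.
Qed.

End BilinearForms.

(** * Banach spaces with independent blocks *)

Notation atom n := 'I_(2 ^ n.+1).

Lemma card_atom_gt0 n : (0 < #|{: atom n}|)%N.
Proof. by rewrite card_ord expn_gt0. Qed.

Lemma powR_le_inv {R : realType} (p x y : R) : 0 < p -> 0 <= y ->
  x `^ p <= y `^ p -> x <= y.
Proof.
move=> p0 y0; apply: contraTT; rewrite -!ltNge => yx.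
by apply: gt0_ltr_powR; rewrite // nnegrE// (le_trans y0)// ltW.
Qed.

Lemma sum_ord_widen (V : nmodType) (F : nat -> V) M M' : (M <= M')%N ->
  (forall n, (M <= n)%N -> F n = 0) -> \sum_(n < M') F n = \sum_(n < M) F n.
Proof.
move=> MM' F0; rewrite -!(big_mkord xpredT F) (big_cat_nat _ MM')//=.
rewrite [X in _ + X]big_nat_cond [X in _ + X]big1 ?addr0//.
by move=> n /andP[/andP[Mn _] _]; exact: F0.
Qed.

Lemma avg_norm_le {R : realType} (T : finType) (p : R) (v : T -> R) c : 1 < p ->
  (0 < #|T|)%N -> 0 <= c ->
  avg (fun a => `|v a| `^ p) <= c `^ p -> avg (fun a => `|v a|) <= c.
Proof.
move=> p1 T0 c0 vc; apply: (powR_le_inv (lt_trans ltr01 p1)) => //.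
apply: le_trans vc.
have := jensen_avg (fun a => `|v a|) T0 (subdifferentiable_powR p1).
rewrite ger0_norm ?avg_ge0// => /le_trans; apply.
by apply: le_avg => a /=; rewrite normr_id.
Qed.

(* The [n]-th block is a copy of the mean-zero functions on [2 ^ n.+1] points,
   and different blocks are independent as far as the [p]-norm can tell. *)
Record block_system {R : realType} (p : R) (X : normedModType R) := BlockSystem {
  block : forall n, {linear (atom n -> R) -> X};
  block_law : forall (N : nat -> nat) (F : forall n, atom (N n) -> R) s,
    uniq [seq N n | n <- s] -> (forall n, mean_zero (F n)) ->
    `|\sum_(n <- s) block (N n) (F n)| `^ p =
    indep_mean (fun t => `|t| `^ p) F s 0;
  block_dense : closure [set x | exists M (G : forall n, atom n -> R),
    (forall n, mean_zero (G n)) /\ x = \sum_(n < M) block n (G n)] = setT }.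

Section BlockSums.
Context {R : realType} {p : R} (p1 : 1 < p).
Context {X : completeNormedModType R} (S : block_system p X).
Implicit Types (x y : X) (G : forall n, atom n -> R).
Local Notation block := (block S).
Local Notation Eabs := (indep_mean (fun t => `|t| `^ p)).

Let p0 : 0 < p. Proof. exact: lt_trans ltr01 p1. Qed.

Let subdiff_powp : subdifferentiable (fun t => `|t| `^ p).
Proof. exact: subdifferentiable_powR. Qed.

Definition finite_family M G : Prop :=
  (forall n, mean_zero (G n)) /\ forall n, (M <= n)%N -> G n = 0.

Definition block_sum M G : X := \sum_(n < M) block n (G n).

Lemma finite_family_lin a M M' G G' : finite_family M G -> finite_family M' G' ->
  finite_family (maxn M M') (fun n => a *: G n + G' n).
Proof.
move=> [mG G0] [mG' G0']; split => [n|n]; first exact: mean_zero_lin.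
by rewrite geq_max => /andP[Mn Mn']; rewrite G0// G0'// scaler0 addr0.
Qed.

Lemma block_sum_widen M M' G : finite_family M G -> (M <= M')%N ->
  block_sum M' G = block_sum M G.
Proof.
move=> [_ G0] MM'.
by apply: (sum_ord_widen (F := fun n => block n (G n))) => // n /G0 ->; rewrite linear0.
Qed.

Lemma block_sum_lin a M M' G G' : finite_family M G -> finite_family M' G' ->
  block_sum (maxn M M') (fun n => a *: G n + G' n) =
  a *: block_sum M G + block_sum M' G'.
Proof.
move=> fG fG'; rewrite -(block_sum_widen fG (leq_maxl M M')).
rewrite -(block_sum_widen fG' (leq_maxr M M')) /block_sum scaler_sumr -big_split/=.
by apply: eq_bigr => n _; rewrite linearP.
Qed.

Lemma block_sum_dense :
  closure [set x | exists M G, finite_family M G /\ x = block_sum M G] = setT.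
Proof.
rewrite -(block_dense S); congr closure; apply/seteqP; split => x.
  by move=> [M [G [[mG _] ->]]]; exists M, G.
move=> [M [G [mG ->]]]; exists M, (fun n => if (n < M)%N then G n else 0).
split; first split => n; first by case: ifP => // _; exact: mean_zero0.
  by rewrite leqNgt => /negbTE ->.
by apply: eq_bigr => n _; rewrite ltn_ord.
Qed.

Lemma block_sum_law (N : nat -> nat) (F : forall n, atom (N n) -> R) M :
  injective N -> (forall n, mean_zero (F n)) ->
  `|\sum_(n < M) block (N n) (F n)| `^ p = Eabs F (iota 0 M) 0.
Proof.
move=> Ninj mF; rewrite -(block_law S)//; last by rewrite map_inj_uniq ?iota_uniq.
by rewrite -(big_mkord xpredT (fun n => block (N n) (F n))) /index_iota subn0.
Qed.

Lemma norm_block n (v : atom n -> R) : mean_zero v ->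
  `|block n v| `^ p = avg (fun a => `|v a| `^ p).
Proof.
move=> mv; have := @block_law _ _ _ S (fun=> n) (fun=> v) [:: 0%N] isT (fun=> mv).
by rewrite big_seq1 => ->; apply: eq_avg => a; rewrite add0r.
Qed.

Lemma norm_block_le n (v : atom n -> R) c : mean_zero v -> 0 <= c ->
  (forall a, `|v a| <= c) -> `|block n v| <= c.
Proof.
move=> mv c0 vc; apply: (powR_le_inv p0) => //; rewrite norm_block//.
apply: avg_le_cst (card_atom_gt0 n) _ => a.
by apply: ge0_ler_powR; rewrite ?nnegrE// ltW.
Qed.

Lemma norm_block_sum_component M G n : (forall k, mean_zero (G k)) -> (n < M)%N ->
  `|block n (G n)| <= `|block_sum M G|.
Proof.
move=> mG nM; apply: (powR_le_inv p0) => //.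
rewrite (block_sum_law (N := id))// norm_block//.
apply: le_trans (indep_mean_filter subdiff_powp (pred1 n) _ _ card_atom_gt0 mG).
have -> : [seq k <- iota 0 M | pred1 n k] = [:: n].
  by rewrite filter_pred1_uniq ?iota_uniq// mem_iota.
by rewrite le_eqVlt; apply/orP; left; apply/eqP/eq_avg => a /=; rewrite add0r.
Qed.

Lemma norm_le_card_block n (v : atom n -> R) a : mean_zero v ->
  `|v a| <= #|{: atom n}|%:R * `|block n v|.
Proof.
move=> mv; have := avg_norm_le p1 (card_atom_gt0 n) (normr_ge0 (block n v)) (v := v).
rewrite norm_block// lexx => /(_ isT).
rewrite /avg ler_pdivrMl ?ltr0n ?card_atom_gt0//; apply: le_trans.
by rewrite (bigD1 a)//= lerDl sumr_ge0.
Qed.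

Definition single n (v : atom n -> R) : forall k, atom k -> R :=
  eqtype.dfwith (fun k => 0 : atom k -> R) v.
Arguments single {n} v k.

Lemma single_finite n (v : atom n -> R) : mean_zero v -> finite_family n.+1 (single v).
Proof.
move=> mv; rewrite /single; split => k.
  have [<-|nk] := eqVneq n k; first by rewrite dfwith_in.
  by rewrite dfwith_out//; exact: mean_zero0.
by move=> nk; rewrite dfwith_out// ltn_eqF.
Qed.

Lemma sum_single (V : nmodType) n (v : atom n -> R) (g : forall k, (atom k -> R) -> V) :
  (forall k, g k 0 = 0) -> \sum_(k < n.+1) g k (single v k) = g n v.
Proof.
move=> g0; rewrite (bigD1 ord_max)//= {1}/single dfwith_in big1 ?addr0// => k kn.
by rewrite /single dfwith_out ?g0// eq_sym; move: kn; rewrite -val_eqE.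
Qed.

Lemma block_sum_single n (v : atom n -> R) : block_sum n.+1 (single v) = block n v.
Proof. by apply: (sum_single v (g := fun k => block k)) => k; exact: linear0. Qed.

Lemma extend_block_sum {Y : completeNormedModType R}
    (f : nat -> (forall n, atom n -> R) -> Y) (C : R) : 0 <= C ->
  (forall M M' G, finite_family M G -> (M <= M')%N -> f M' G = f M G) ->
  (forall a M G G', f M (fun n => a *: G n + G' n) = a *: f M G + f M G') ->
  (forall M G, finite_family M G -> `|f M G| <= C * `|block_sum M G|) ->
  exists2 F : {linear X -> Y}, op_bound F C &
    forall M G, finite_family M G -> F (block_sum M G) = f M G.
Proof.
move=> C0 f_widen f_lin f_bound.
pose graph (x : X) (y : Y) := exists M G, [/\ finite_family M G, x = block_sum M G & y = f M G].
have [||||F bF graphF] := @extend_graph R X Y graph C.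
- by [].
- move=> a x y x' y' [M [G [fG -> ->]]] [M' [G' [fG' -> ->]]].
  exists (maxn M M'), (fun n => a *: G n + G' n); split.
  + exact: finite_family_lin.
  + by rewrite block_sum_lin.
  + by rewrite f_lin (f_widen _ _ _ fG (leq_maxl M M')) (f_widen _ _ _ fG' (leq_maxr M M')).
- by move=> x y [M [G [fG -> ->]]]; exact: f_bound.
- rewrite -block_sum_dense; congr closure; apply/seteqP; split => x.
    by move=> [y [M [G [fG -> _]]]]; exists M, G.
  by move=> [M [G [fG ->]]]; exists (f M G), M, G.
by exists F => // M G fG; apply: graphF; exists M, G.
Qed.

Lemma coord_exists n (a : atom n) : exists2 c : {linear X -> R^o},
  op_bound c #|{: atom n}|%:R &
  forall M G, finite_family M G -> c (block_sum M G) = G n a.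
Proof.
apply: (extend_block_sum (f := fun _ G => G n a)) => // M G [mG G0].
apply: le_trans (norm_le_card_block a (mG n)) _; rewrite ler_wpM2l//.
have [nM|Mn] := ltnP n M; first exact: norm_block_sum_component.
by rewrite G0// linear0 normr0.
Qed.

Definition coord n (a : atom n) : {linear X -> R^o} := sval (cid2 (coord_exists a)).

Lemma coord_bound n (a : atom n) : op_bound (coord a) #|{: atom n}|%:R.
Proof. by rewrite /coord; case: cid2. Qed.

Lemma coord_block_sum M G n (a : atom n) : finite_family M G ->
  coord a (block_sum M G) = G n a.
Proof. by rewrite /coord; case: cid2 => c /= _ cE fG; exact: cE. Qed.

Lemma coord_continuous n (a : atom n) : continuous (coord a).
Proof. exact: op_bound_continuous (coord_bound a). Qed.

Definition coords n x : atom n -> R := fun a => coord a x.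
Arguments coords : clear implicits.

Lemma coords_block_sum M G n : finite_family M G -> coords n (block_sum M G) = G n.
Proof. by move=> fG; apply/funext => a; exact: coord_block_sum. Qed.

Lemma coords_block i (v : atom i -> R) j : mean_zero v ->
  coords j (block i v) = single v j.
Proof. by move=> mv; rewrite -block_sum_single coords_block_sum//; exact: single_finite. Qed.

Lemma block_sum_ext (Y : normedModType R) (f g : X -> Y) :
  continuous f -> continuous g ->
  (forall M G, finite_family M G -> f (block_sum M G) = g (block_sum M G)) -> f =1 g.
Proof.
move=> fc gc fg; apply: dense_ext fc gc block_sum_dense _.
by move=> x [M [G [fG ->]]]; exact: fg.
Qed.

Lemma block_sum_op_bound (Y : normedModType R) (f : X -> Y) c : continuous f ->
  (forall M G, finite_family M G -> `|f (block_sum M G)| <= c * `|block_sum M G|) ->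
  op_bound f c.
Proof.
move=> fc fG; apply: dense_le_norm fc block_sum_dense _.
by move=> x [M [G [fG' ->]]]; exact: fG.
Qed.

Lemma coords_mean_zero x n : mean_zero (coords n x).
Proof.
apply: (block_sum_ext (f := fun x => \sum_a coords n x a : R^o) (g := fun=> 0)).
- by apply: continuous_big => [|a _]; [exact: add_continuous|exact: coord_continuous].
- by move=> y; exact: cvg_cst.
- by move=> M G fG; rewrite coords_block_sum//; have [mG _] := fG; exact: mG.
Qed.

Lemma block_coords_continuous n : continuous (fun x => block n (coords n x)).
Proof.
have -> : (fun x => block n (coords n x)) =
    (fun x => \sum_a coord a x *: block n (fun b => (b == a)%:R)).
  apply/funext => x; under [RHS]eq_bigr do rewrite -linearZ; rewrite -linear_sum/=.
  congr (block n _); apply/funext => b; rewrite fct_sumE (bigD1 b)//= big1.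
    by rewrite addr0 fctE eqxx /GRing.scale/= mulr1.
  by move=> a ab; rewrite fctE eq_sym (negbTE ab) scaler0.
apply: continuous_big => [|a _]; first exact: add_continuous.
by move=> x; apply: cvgZl; exact: coord_continuous.
Qed.

Definition partial_sum M x := \sum_(n < M) block n (coords n x).

Lemma partial_sum_bound M : op_bound (partial_sum M) 1.
Proof.
apply: block_sum_op_bound => [x|M' G fG].
  move: x; apply: continuous_big => [|n _]; first exact: add_continuous.
  exact: block_coords_continuous.
have [mG G0] := fG; have -> : partial_sum M (block_sum M' G) = block_sum M G.
  by apply: eq_bigr => n _; rewrite coords_block_sum.
rewrite mul1r; have [MM'|/ltnW M'M] := leqP M M'; last by rewrite (block_sum_widen fG).
apply: (powR_le_inv p0) => //; rewrite !(block_sum_law (N := id))//.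
apply: le_trans (indep_mean_filter subdiff_powp (fun n => (n < M)%N) _ _ card_atom_gt0 mG).
have -> // : [seq n <- iota 0 M' | (n < M)%N] = iota 0 M.
apply: (irr_sorted_eq ltn_trans ltnn).
- by rewrite sorted_filter ?iota_ltn_sorted//; exact: ltn_trans.
- exact: iota_ltn_sorted.
- move=> n; rewrite mem_filter !mem_iota/= !add0n.
  by case: ltnP => // nM; rewrite (leq_trans nM).
Qed.

Lemma partial_sum_cvg x : partial_sum M x @[M --> \oo] --> x.
Proof.
apply/cvgrPdist_le => e e0; have e20 : 0 < e / 2 by rewrite divr_gt0.
have : closure [set x | exists M G, finite_family M G /\ x = block_sum M G] x.
  by rewrite block_sum_dense.
move=> /(_ _ (nbhsx_ballx x _ e20))[_ [[M [G [fG ->]]]]].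
rewrite -ball_normE/= => xG; exists M => // M' /= MM'.
have sumG : partial_sum M' (block_sum M G) = block_sum M G.
  rewrite -[RHS](block_sum_widen fG MM'); apply: eq_bigr => n _.
  by rewrite coords_block_sum.
have sumB : partial_sum M' x - partial_sum M' (block_sum M G) =
    partial_sum M' (x - block_sum M G).
  rewrite -sumrB; apply: eq_bigr => n _; rewrite -linearB; congr (block _ _).
  by apply/funext => a; rewrite !fctE /coords linearB.
have := partial_sum_bound M' (x - block_sum M G); rewrite mul1r -sumB sumG => h.
have -> : x - partial_sum M' x =
    (x - block_sum M G) - (partial_sum M' x - block_sum M G).
  by rewrite opprB addrA subrK.
by apply: le_trans (ler_normB _ _) _; lra.
Qed.

Lemma norm_le_partial_sums x c : (forall M, `|partial_sum M x| <= c) -> `|x| <= c.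
Proof.
move=> xc; have cvgx : `|partial_sum M x| @[M --> \oo] --> `|x|.
  by apply: cvg_norm; exact: partial_sum_cvg.
rewrite -(cvg_lim _ cvgx)//; apply: limr_le; last exact: nearW.
by apply/cvg_ex; exists `|x|.
Qed.

Lemma avg_coords_powR n x : avg (fun a => `|coords n x a| `^ p) <= `|x| `^ p.
Proof.
rewrite -norm_block; last exact: coords_mean_zero.
apply: ge0_ler_powR; rewrite ?nnegrE//; first exact: ltW.
apply: le_trans (norm_block_sum_component (fun n => coords_mean_zero x n) (ltnSn n)) _.
by have := partial_sum_bound n.+1 x; rewrite mul1r.
Qed.

Lemma avg_norm_coords n x : avg (fun a => `|coords n x a|) <= `|x|.
Proof.
exact: avg_norm_le p1 (card_atom_gt0 n) (normr_ge0 x) (avg_coords_powR n x).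
Qed.

Definition pairing n (w : atom n -> R) x : R := avg (fun a => coord a x * w a).

Lemma pairing_lin n (w : atom n -> R) : linear_for *%R (pairing w).
Proof.
move=> c x y; rewrite /pairing -avgZ -avgD; apply: eq_avg => a.
by rewrite linearP mulrDl mulrA.
Qed.

HB.instance Definition _ n (w : atom n -> R) :=
  GRing.isLinear.Build R X R *%R (pairing w) (pairing_lin w).

Definition dual_pairing n x (w : atom n -> R) : R := pairing w x.
Arguments dual_pairing : clear implicits.

Lemma dual_pairing_lin n x : linear_for *%R (dual_pairing n x).
Proof.
move=> c v w; rewrite /dual_pairing /pairing -avgZ -avgD; apply: eq_avg => a.
by rewrite mulrDr /GRing.scale/= mulrCA.
Qed.

HB.instance Definition _ n x :=
  GRing.isLinear.Build R (atom n -> R) R *%R (dual_pairing n x) (@dual_pairing_lin n x).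

Lemma pairing_le n (w : atom n -> R) x : (forall a, `|w a| <= 1) ->
  `|pairing w x| <= `|x|.
Proof.
move=> w1; apply: le_trans (ler_norm_avg _) _; apply: le_trans (avg_norm_coords n x).
by apply: le_avg => a; rewrite normrM ler_piMr.
Qed.

End BlockSums.

Arguments coords {R p} p1 {X} S n x.
Arguments block_sum {R p X} S M G.
Arguments single {R n} v k.
Arguments dual_pairing {R p} p1 {X} S n x w.

(** * Copies of the space inside itself *)

Lemma incr_ge_id (N : nat -> nat) : {homo N : i j / (i < j)%N} ->
  forall n, (n <= N n)%N.
Proof. by move=> Nincr; elim=> // n IH; apply: leq_ltn_trans IH (Nincr _ _ _). Qed.

Lemma map_incr_iota (N : nat -> nat) M : {homo N : i j / (i < j)%N} ->
  [seq N n | n <- iota 0 M] =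
  [seq k <- iota 0 (N M) | k \in [seq N n | n <- iota 0 M]].
Proof.
move=> Nincr; apply: (irr_sorted_eq ltn_trans ltnn).
- by rewrite (homo_sorted Nincr)// iota_ltn_sorted.
- by rewrite sorted_filter ?iota_ltn_sorted//; exact: ltn_trans.
move=> k; rewrite mem_filter mem_iota/= add0n.
case: (boolP (k \in _)) => //= /mapP[n]; rewrite mem_iota/= => nM ->.
by rewrite Nincr.
Qed.

Section Copies.
Context {R : realType} {p : R} (p1 : 1 < p).
Context {X : completeNormedModType R} (S : block_system p X).
Variables (N : nat -> nat) (rho : forall n, atom (N n) -> atom n).
Arguments rho : clear implicits.
Hypothesis Nincr : {homo N : i j / (i < j)%N}.
Hypothesis rho_eq : forall n, equidistributed (rho n).
Implicit Types (x : X) (G : forall n, atom n -> R).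
Local Notation block := (block S).
Local Notation block_sum := (block_sum S).
Local Notation coords := (coords p1 S).

Let p0 : 0 < p. Proof. exact: lt_trans ltr01 p1. Qed.

Let subdiff_powp : subdifferentiable (fun t => `|t| `^ p).
Proof. exact: subdifferentiable_powR. Qed.

Let Ninj : injective N. Proof. exact: incn_inj (leq_mono Nincr). Qed.

Let card_copy_gt0 n : (0 < #|{: atom (N n)}|)%N. Proof. exact: card_atom_gt0. Qed.

Definition copy_sum M G : X := \sum_(n < M) block (N n) (G n \o rho n).

Definition cond_exp_family G n : atom n -> R := cond_exp (rho n) (G (N n)).
Arguments cond_exp_family : clear implicits.

Lemma embed_exists : exists2 B : {linear X -> X}, op_bound B 1 &
  forall M G, finite_family M G -> B (block_sum M G) = copy_sum M G.
Proof.
apply: extend_block_sum => //.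
- move=> M M' G [_ G0] MM'.
  apply: (sum_ord_widen (F := fun n => block (N n) (G n \o rho n))) => // n /G0 ->.
  exact: linear0.
- move=> a M G G'; rewrite /copy_sum scaler_sumr -big_split/=.
  by apply: eq_bigr => n _; rewrite -linearP.
- move=> M G [mG _]; rewrite mul1r; apply: (powR_le_inv p0) => //.
  have mGr n : mean_zero (G n \o rho n) by exact: mean_zero_comp.
  rewrite /copy_sum (block_sum_law S _ Ninj mGr) (block_sum_law S (N := id))//.
  by rewrite (indep_mean_copy _ _ _ _ card_copy_gt0 rho_eq).
Qed.

Lemma cond_exp_family_finite M G :
  finite_family M G -> finite_family M (cond_exp_family G).
Proof.
move=> [mG G0]; split => n; first exact: cond_exp_mean_zero.
move=> Mn; rewrite /cond_exp_family G0 ?(leq_trans Mn) ?incr_ge_id//.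
by apply/funext => u; rewrite /cond_exp big1 ?mulr0.
Qed.

Lemma project_exists : exists2 A : {linear X -> X}, op_bound A 1 &
  forall M G, finite_family M G -> A (block_sum M G) = block_sum M (cond_exp_family G).
Proof.
apply: extend_block_sum => //.
- by move=> M M' G fG MM'; apply: block_sum_widen => //; exact: cond_exp_family_finite.
- move=> a M G G'; rewrite /block_sum scaler_sumr -big_split/=.
  by apply: eq_bigr => n _; rewrite -linearP; congr (block _ _); exact: cond_exp_lin.
- move=> M G fG; have [mG G0] := fG; have [mC _] := cond_exp_family_finite fG.
  rewrite mul1r -(block_sum_widen S fG (incr_ge_id Nincr M)).
  apply: (powR_le_inv p0) => //; rewrite !(block_sum_law S (N := id))//.
  apply: le_trans (indep_mean_cond_exp subdiff_powp _ _ _ card_copy_gt0 rho_eq) _.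
  rewrite -(indep_mean_map _ G N) map_incr_iota//.
  exact: (indep_mean_filter subdiff_powp (mem [seq N n | n <- iota 0 M]) _ _ card_atom_gt0 mG).
Qed.

Definition embed : {linear X -> X} := sval (cid2 embed_exists).
Definition project : {linear X -> X} := sval (cid2 project_exists).

Lemma embed_bound : op_bound embed 1.
Proof. by rewrite /embed; case: cid2. Qed.

Lemma project_bound : op_bound project 1.
Proof. by rewrite /project; case: cid2. Qed.

Lemma embed_block_sum M G : finite_family M G -> embed (block_sum M G) = copy_sum M G.
Proof. by rewrite /embed; case: cid2 => B /= _ BE fG; exact: BE. Qed.

Lemma project_block_sum M G : finite_family M G ->
  project (block_sum M G) = block_sum M (cond_exp_family G).
Proof. by rewrite /project; case: cid2 => A /= _ AE fG; exact: AE. Qed.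

Lemma embed_block n (v : atom n -> R) : mean_zero v ->
  embed (block n v) = block (N n) (v \o rho n).
Proof.
move=> mv; rewrite -block_sum_single embed_block_sum; last exact: single_finite.
by apply: (sum_single v (g := fun k f => block (N k) (f \o rho k))) => k; exact: linear0.
Qed.

Lemma project_block n (v : atom (N n) -> R) : mean_zero v ->
  project (block (N n) v) = block n (cond_exp (rho n) v).
Proof.
move=> mv; rewrite -block_sum_single project_block_sum; last exact: single_finite.
have nN : (n < (N n).+1)%N by rewrite ltnS incr_ge_id.
rewrite /block_sum (bigD1 (Ordinal nN))//= big1 ?addr0.
  by rewrite /cond_exp_family /single dfwith_in.
move=> k kn; rewrite /cond_exp_family /single dfwith_out.
  rewrite (_ : cond_exp _ _ = 0) ?linear0//.
  by apply/funext => u; rewrite /cond_exp big1 ?mulr0.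
by apply: contra kn => /eqP/Ninj nk; apply/eqP/val_inj.
Qed.

Lemma project_embed x : project (embed x) = x.
Proof.
apply: (block_sum_ext (S := S) (f := project \o embed) (g := idfun)) => [||M G fG].
- move=> y; apply: continuous_comp; apply: op_bound_continuous.
    exact: embed_bound.
  exact: project_bound.
- by move=> y; exact: cvg_id.
have [mG _] := fG; rewrite /= embed_block_sum// linear_sum; apply: eq_bigr => n _.
rewrite project_block; last exact: mean_zero_comp.
by congr (block _ _); exact: cond_exp_comp.
Qed.

Lemma coords_project x n : coords n (project x) = cond_exp (rho n) (coords (N n) x).
Proof.
apply/funext => u; apply: (block_sum_ext (S := S) (Y := R^o)
  (f := fun x => coords n (project x) u) (g := fun x => cond_exp (rho n) (coords (N n) x) u)).
- move=> y; apply: continuous_comp; last exact: coord_continuous.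
  exact: op_bound_continuous project_bound _.
- move=> y; apply: cvgMr; move: y; apply: continuous_big => [|a _].
    exact: add_continuous.
  exact: coord_continuous.
move=> M G fG; rewrite project_block_sum// !coords_block_sum//.
exact: cond_exp_family_finite.
Qed.

End Copies.

(** * Compression to a copy of the space *)

Section CentredIndicators.
Context {R : realType} {T : finType}.
Implicit Types (b c : T) (f v : T -> R).

Definition cdelta b : T -> R := fun c => (c == b)%:R - #|T|%:R^-1.

Lemma sum_delta f b : \sum_c f c * (c == b)%:R = f b.
Proof.
rewrite (bigD1 b)//= eqxx mulr1 big1 ?addr0// => c /negbTE ->.
by rewrite mulr0.
Qed.

Lemma cond_exp_cdelta (T' : finType) (rho : T' -> T) (f : T' -> R) b : mean_zero f ->
  cond_exp rho f b = #|T|%:R * avg (fun x => f x * cdelta b (rho x)).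
Proof.
move=> f0; rewrite /cond_exp /avg mulrA; congr (_ * _).
under [RHS]eq_bigr do rewrite mulrBr; rewrite sumrB -mulr_suml f0 mul0r subr0.
rewrite big_mkcond; apply: eq_bigr => x _.
by case: eqP => _; rewrite ?mulr1 ?mulr0.
Qed.

Lemma avg_mul_cdelta f b : mean_zero f -> #|T|%:R * avg (fun c => f c * cdelta b c) = f b.
Proof.
move=> f0; have T0 : (0 < #|T|)%N by apply/card_gt0P; exists b.
have id_eq : equidistributed (id : T -> T).
  by move=> c; rewrite -[RHS]mul1n -(card1 c); congr (_ * _)%N; apply: eq_card.
rewrite -(cond_exp_cdelta id b f0).
exact: (congr1 (fun v => v b) (cond_exp_comp id_eq T0 f)).
Qed.

Lemma cdelta_mean_zero b : mean_zero (cdelta b).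
Proof.
have T0 : #|T|%:R != 0 :> R by rewrite pnatr_eq0 -lt0n; apply/card_gt0P; exists b.
rewrite /mean_zero sumrB sumr_const -[X in _ - X]mulr_natl mulfV//.
by have := sum_delta (fun=> 1) b; under eq_bigr do rewrite mul1r; move=> ->; rewrite subrr.
Qed.

Lemma cdelta_expand v : mean_zero v -> v = \sum_b v b *: cdelta b.
Proof.
move=> v0; apply/funext => c; rewrite fct_sumE.
transitivity (\sum_b (v b * (b == c)%:R - v b * #|T|%:R^-1)).
  by rewrite sumrB sum_delta -mulr_suml v0 mul0r subr0.
by apply: eq_bigr => b _; rewrite fctE -mulrBr eq_sym.
Qed.

Lemma norm_cdelta_le1 b c : `|cdelta b c| <= 1.
Proof.
have T0 : (0 < #|T|)%N by apply/card_gt0P; exists b.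
have : 0 <= (#|T|%:R^-1 : R) <= 1 by rewrite invr_ge0 ler0n/= invf_le1 ?ltr0n// ler1n.
by rewrite /cdelta ler_norml; case: (c == b) => /=; lra.
Qed.

End CentredIndicators.

(* Summable over all pairs of blocks, even against [#|atom i| * #|atom j|]. *)
Definition tolerance {R : realType} (i j : nat) : R :=
  (16 * (2 ^+ i * 2 ^+ j) * (#|{: atom i}|%:R * #|{: atom j}|%:R))^-1.

Section Compression.
Context {R : realType} {p : R} (p1 : 1 < p).
Context {X : completeNormedModType R} (S : block_system p X).
Variables (T : {linear X -> X}) (C : R).
Hypothesis bT : op_bound T C.
Variables (N : nat -> nat) (rho : forall n, atom (N n) -> atom n) (lam : R).
Arguments rho : clear implicits.
Hypothesis Nincr : {homo N : i j / (i < j)%N}.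
Hypothesis rho_eq : forall n, equidistributed (rho n).
Local Notation block := (block S).
Local Notation coords := (coords p1 S).
Local Notation pairing := (pairing p1 S).
Local Notation A := (project p1 S Nincr rho_eq).
Local Notation B := (embed p1 S Nincr rho_eq).

Let entry i j (b : atom i) (b' : atom j) : R :=
  pairing (cdelta b' \o rho j) (T (block (N i) (cdelta b \o rho i))).

Hypothesis entry_diag : forall i (b b' : atom i),
  `|entry b b' - lam * avg (fun c => cdelta b c * cdelta b' c)| <= tolerance i i.
Hypothesis entry_offdiag : forall i j (b : atom i) (b' : atom j),
  i != j -> `|entry b b'| <= tolerance i j.

Let compress x := A (T (B x)).

Let coords_compress i (v : atom i -> R) j (b' : atom j) : mean_zero v ->
  coords j (compress (block i v)) b' = #|{: atom j}|%:R * \sum_b v b * entry b b'.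
Proof.
move=> mv; rewrite /compress coords_project cond_exp_cdelta; last exact: coords_mean_zero.
congr (_ * _); rewrite embed_block// {1}(cdelta_expand mv).
rewrite (_ : (\sum_b _) \o rho i = \sum_b v b *: (cdelta b \o rho i)); last first.
  by apply/funext => a; rewrite /= !fct_sumE.
transitivity (pairing (cdelta b' \o rho j)
    (T (block (N i) (\sum_b v b *: (cdelta b \o rho i))))); first by [].
by rewrite !linear_sum; apply: eq_bigr => b _; rewrite !linearZ.
Qed.

Let error x := compress x - lam *: x.

Let coords_error i (v : atom i -> R) j (b' : atom j) : mean_zero v ->
  exists2 E : atom i -> R, (forall b, `|E b| <= tolerance i j) &
    coords j (error (block i v)) b' = #|{: atom j}|%:R * \sum_b v b * E b.
Proof.
move=> mv; have errorE : coords j (error (block i v)) b' =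
    coords j (compress (block i v)) b' - lam * single v j b'.
  by rewrite -(coords_block p1 S)// /coords -linearZ -linearB.
have [ij|ij] := eqVneq i j; last first.
  exists (fun b => entry b b'); first by move=> b; exact: entry_offdiag.
  by rewrite errorE coords_compress// /single dfwith_out// mulr0 subr0.
subst j; exists (fun b => entry b b' - lam * avg (fun c => cdelta b c * cdelta b' c)).
  by move=> b; exact: entry_diag.
rewrite errorE coords_compress// /single dfwith_in -[v b'](avg_mul_cdelta b' mv).
rewrite mulrCA -mulrBr; congr (_ * _).
under [RHS]eq_bigr do rewrite mulrBr; rewrite sumrB; congr (_ - _).
under [RHS]eq_bigr do rewrite mulrCA -avgZ; rewrite -mulr_sumr -avg_sum.
congr (_ * _); apply: eq_avg => c; rewrite {1}(cdelta_expand mv) fct_sumE mulr_suml.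
by apply: eq_bigr => b _; rewrite fctE mulrA.
Qed.

Let norm_coords_error i (v : atom i -> R) j (b' : atom j) : mean_zero v ->
  `|coords j (error (block i v)) b'| <=
    16^-1 * 2^-1 ^+ i * `|block i v| * 2^-1 ^+ j.
Proof.
move=> mv; have [E E_le ->] := coords_error b' mv.
have cards n : 0 < #|{: atom n}|%:R :> R by rewrite ltr0n card_atom_gt0.
have sumv : \sum_b `|v b| <= #|{: atom i}|%:R * `|block i v|.
  rewrite -ler_pdivrMl//; apply: (avg_norm_le p1 (card_atom_gt0 i)) => //.
  by rewrite norm_block.
have tolerance0 : 0 <= tolerance i j :> R by rewrite invr_ge0 !mulr_ge0// exprn_ge0.
rewrite normrM ger0_norm//.
apply: (@le_trans _ _ (#|{: atom j}|%:R * (#|{: atom i}|%:R * `|block i v| * tolerance i j))).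
  rewrite ler_wpM2l//; apply: le_trans (ler_norm_sum _ _ _) _.
  apply: le_trans (ler_wpM2r tolerance0 sumv); rewrite mulr_suml; apply: ler_sum => b _.
  by rewrite normrM ler_wpM2l.
rewrite le_eqVlt; apply/orP; left; apply/eqP; rewrite /tolerance !exprVn.
by field; rewrite !expf_neq0//= !gt_eqF// cards.
Qed.

Let norm_error_block i (v : atom i -> R) : mean_zero v ->
  `|error (block i v)| <= 8^-1 * 2^-1 ^+ i * `|block i v|.
Proof.
move=> mv; set y := error _; set c := 8^-1 * _ * _.
have c0 : 0 <= 16^-1 * 2^-1 ^+ i * `|block i v|.
  by rewrite !mulr_ge0// ?exprn_ge0// invr_ge0.
apply: (norm_le_partial_sums (p1 := p1) (S := S)) => M.
apply: le_trans (ler_norm_sum _ _ _) _.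
apply: (@le_trans _ _ (\sum_(j < M) 16^-1 * 2^-1 ^+ i * `|block i v| * 2^-1 ^+ j)).
  apply: ler_sum => j _; apply: norm_block_le => //; first exact: coords_mean_zero.
  by move=> b; exact: norm_coords_error.
rewrite -mulr_sumr; apply: le_trans (ler_wpM2l c0 (sum_half_powers_le M)) _.
by rewrite /c; lra.
Qed.

Lemma compression_almost_scalar x : `|A (T (B x)) - lam *: x| <= 4^-1 * `|x|.
Proof.
rewrite -/(error x); move: x.
have error_cont : continuous error.
  move=> x; apply: cvgB; last by apply: cvgZr; exact: cvg_id.
  apply: (continuous_comp (f := T \o B)).
    apply: continuous_comp; first exact: op_bound_continuous (embed_bound _ _ _ _) _.
    exact: op_bound_continuous bT _.
  exact: op_bound_continuous (project_bound _ _ _ _) _.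
apply: (block_sum_op_bound (S := S) error_cont) => M G [mG _].
have -> : error (block_sum S M G) = \sum_(n < M) error (block n (G n)).
  by rewrite /error /compress (linear_sum B) (linear_sum T) (linear_sum A) scaler_sumr -sumrB.
apply: le_trans (ler_norm_sum _ _ _) _.
apply: (@le_trans _ _ (\sum_(n < M) 8^-1 * `|block_sum S M G| * 2^-1 ^+ n)).
  apply: ler_sum => n _; apply: le_trans (norm_error_block (mG n)) _.
  rewrite mulrAC ler_wpM2r ?exprn_ge0 ?invr_ge0// ler_wpM2l ?invr_ge0//.
  exact: norm_block_sum_component.
rewrite -mulr_sumr.
have c0 : 0 <= 8^-1 * `|block_sum S M G| by rewrite mulr_ge0// invr_ge0.
by apply: le_trans (ler_wpM2l c0 (sum_half_powers_le M)) _; lra.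
Qed.

End Compression.

(** * Random copies of a block *)

Lemma ler_sum_sqr {R : realType} (I : finType) (x q : I -> R) (M B : R) :
  (forall i, `|x i| <= q i) -> (forall i, q i <= M) -> 0 <= M -> \sum_i q i <= B ->
  \sum_i x i ^+ 2 <= M * B.
Proof.
move=> xq qM M0 qB; apply: le_trans (ler_wpM2l M0 qB); rewrite mulr_sumr.
apply: ler_sum => i _; rewrite -real_normK ?num_real// expr2.
by apply: ler_pM => //; exact: le_trans (qM i).
Qed.

Section GroupedBlock.
Context {R : realType} {p : R} (p1 : 1 < p).
Context {X : completeNormedModType R} (S : block_system p X).
Variables (N : nat) (K L : finType) (phi : K * L -> atom N) (psi : atom N -> K * L).
Hypotheses (phiK : cancel phi psi) (psiK : cancel psi phi).
Implicit Types (x y : X) (k l : K) (c d : L).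
Local Notation block := (block S).
Local Notation coord := (coord p1 S).
Local Notation coords := (coords p1 S).
Local Notation pairing := (pairing p1 S).
Local Notation sample := {ffun K -> {perm L}}.

Let p0 : 0 < p. Proof. exact: lt_trans ltr01 p1. Qed.

Lemma sum_atoms (V : nmodType) (F : atom N -> V) :
  \sum_a F a = \sum_k \sum_c F (phi (k, c)).
Proof.
rewrite pair_bigA/= (reindex phi); first by apply: eq_bigr => -[].
by exists psi => a _; [exact: phiK|exact: psiK].
Qed.

Lemma card_atoms : #|{: atom N}| = (#|K| * #|L|)%N.
Proof. by rewrite -card_prod; apply: (bij_eq_card (f := psi)); exists phi. Qed.

Let K0 : 0 < #|K|%:R :> R.
Proof.
have := card_atom_gt0 N; rewrite card_atoms muln_gt0 ltr0n.
by case/andP.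
Qed.

Let L0 : 0 < #|L|%:R :> R.
Proof.
have := card_atom_gt0 N; rewrite card_atoms muln_gt0 ltr0n.
by case/andP.
Qed.

Definition root_card : R := #|K|%:R `^ p^-1.

Lemma root_card_gt0 : 0 < root_card. Proof. exact: powR_gt0. Qed.

Lemma root_card_powR : root_card `^ p = #|K|%:R.
Proof. by rewrite /root_card -powRrM mulVf ?gt_eqF// powRr1// ltW. Qed.

Definition group_norm y k : R :=
  #|{: atom N}|%:R^-1 * \sum_c `|coord (phi (k, c)) y|.

Lemma group_norm_le y k : group_norm y k <= root_card / #|K|%:R * `|y|.
Proof.
have -> : group_norm y k = avg (fun c => `|coord (phi (k, c)) y|) / #|K|%:R.
  by rewrite /group_norm /avg card_atoms natrM; field; rewrite !gt_eqF.
rewrite [leRHS]mulrAC ler_pM2r ?invr_gt0//; apply: avg_norm_le p1 _ _ _.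
- by rewrite -(ltr0n R).
- by rewrite mulr_ge0// ltW// root_card_gt0.
rewrite powRM// ?(ltW root_card_gt0)// root_card_powR.
apply: le_trans (ler_wpM2l (ltW K0) (avg_coords_powR p1 S N y)).
rewrite /avg card_atoms natrM invfM mulrA mulVKf ?gt_eqF// ler_wpM2l ?invr_ge0//.
by rewrite sum_atoms (bigD1 k)//= lerDl sumr_ge0// => l _; rewrite sumr_ge0.
Qed.

Lemma sum_group_norm_le y : \sum_k group_norm y k <= `|y|.
Proof.
apply: le_trans (avg_norm_coords p1 S N y).
by rewrite /avg sum_atoms mulr_sumr.
Qed.

Lemma norm_block_group_le l (f : atom N -> R) : mean_zero f ->
  (forall a, `|f a| <= 1) -> (forall a, (psi a).1 != l -> f a = 0) ->
  `|block N f| <= root_card^-1.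
Proof.
move=> mf f1 fl; apply: (powR_le_inv p0).
  by rewrite invr_ge0 ltW// root_card_gt0.
rewrite norm_block// -powR_inv1 ?(ltW root_card_gt0)// powRAC root_card_powR powR_inv1//.
rewrite /avg sum_atoms (bigD1 l)//= [X in _ + X]big1 ?addr0; last first.
  move=> k kl; apply: big1 => c _.
  by rewrite fl ?phiK// normr0 powR0// gt_eqF.
apply: (@le_trans _ _ (#|{: atom N}|%:R^-1 * \sum_(c : L) 1)).
  rewrite ler_wpM2l ?invr_ge0//; apply: ler_sum => c _.
  apply: (@le_trans _ _ (1 `^ p)); last by rewrite powR1.
  by rewrite ge0_ler_powR ?nnegrE// ltW.
rewrite sumr_const card_atoms natrM le_eqVlt; apply/orP; left; apply/eqP.
by field; rewrite !gt_eqF.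
Qed.

Section RandomCopy.
Variables (U : finType) (q : L -> U).
Hypothesis q_eq : equidistributed q.
Implicit Types (g : sample) (v w : U -> R).

Definition random_copy g (a : atom N) : U := q (g (psi a).1 (psi a).2).

Lemma random_copyE g k c : random_copy g (phi (k, c)) = q (g k c).
Proof. by rewrite /random_copy phiK. Qed.

Lemma random_copy_equidistributed g : equidistributed (random_copy g).
Proof.
move=> u; rewrite card_atoms -(q_eq u) mulnA; congr (_ * _)%N.
rewrite -[LHS]sum1_card big_mkcond sum_atoms/= -sum_nat_const.
apply: eq_bigr => k _; rewrite -sum1_card [RHS](reindex_inj (@perm_inj _ (g k))).
rewrite -big_mkcond; apply: eq_bigl => c.
by rewrite !inE random_copyE.
Qed.

Definition group_part g v k : atom N -> R :=
  fun a => if (psi a).1 == k then v (random_copy g a) else 0.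

Lemma group_partE g v l k c :
  group_part g v l (phi (k, c)) = if k == l then v (q (g k c)) else 0.
Proof. by rewrite /group_part random_copyE phiK. Qed.

Lemma sum_group_part g v : v \o random_copy g = \sum_k group_part g v k.
Proof.
apply/funext => a; rewrite fct_sumE (bigD1 (psi a).1)//= /group_part eqxx.
by rewrite big1 ?addr0// => k; rewrite eq_sym => /negbTE ->.
Qed.

Lemma group_part_mean_zero g v k : mean_zero v -> mean_zero (group_part g v k).
Proof.
move=> mv; rewrite /mean_zero sum_atoms (bigD1 k)//= [X in _ + X]big1 ?addr0.
  under eq_bigr do rewrite group_partE eqxx.
  rewrite -(reindex_inj (P := xpredT) (F := v \o q) (@perm_inj _ (g k))).
  by apply: mean_zero_comp => //; rewrite -(ltr0n R).
move=> l /negbTE lk; apply: big1 => c _; by rewrite group_partE lk.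
Qed.

Lemma norm_group_part_le1 g v k a : (forall u, `|v u| <= 1) -> `|group_part g v k a| <= 1.
Proof. by move=> v1; rewrite /group_part; case: ifP; rewrite ?normr0. Qed.

Lemma norm_block_group_part g v k : mean_zero v -> (forall u, `|v u| <= 1) ->
  `|block N (group_part g v k)| <= root_card^-1.
Proof.
move=> mv v1; apply: (norm_block_group_le (l := k)).
- exact: group_part_mean_zero.
- by move=> a; exact: norm_group_part_le1.
- by move=> a /negbTE ak; rewrite /group_part ak.
Qed.

Lemma pairing_group_part_le g w k y : (forall u, `|w u| <= 1) ->
  `|pairing (group_part g w k) y| <= group_norm y k.
Proof.
move=> w1; apply: le_trans (ler_norm_avg _) _; rewrite /avg ler_wpM2l ?invr_ge0//.
rewrite sum_atoms (bigD1 k)//= [X in _ + X]big1 ?addr0.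
  by apply: ler_sum => c _; rewrite normrM ler_piMr// norm_group_part_le1.
move=> l /negbTE lk; apply: big1 => c _.
by rewrite group_partE lk mulr0 normr0.
Qed.

Let delta (a : atom N) : atom N -> R := fun b => (b == a)%:R.

Lemma group_part_delta g v k :
  group_part g v k = \sum_c v (q (g k c)) *: delta (phi (k, c)).
Proof.
apply/funext => a; rewrite -(psiK a); case: (psi a) => l c; rewrite group_partE fct_sumE.
have [->|lk] := eqVneq l k.
  rewrite (bigD1 c)//= big1 ?addr0; first by rewrite fctE /delta eqxx /GRing.scale/= mulr1.
  move=> d dc; rewrite fctE /delta (inj_eq (can_inj phiK)) xpair_eqE eqxx eq_sym.
  by rewrite (negbTE dc) scaler0.
rewrite big1// => d _; rewrite fctE /delta (inj_eq (can_inj phiK)) xpair_eqE.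
by rewrite (negbTE lk) scaler0.
Qed.

Lemma avg_sqr_functional (F : {scalar (atom N -> R)}) v (Y : R) : mean_zero v ->
  (forall g, \sum_k F (group_part g v k) ^+ 2 <= Y) ->
  avg (fun g => F (v \o random_copy g) ^+ 2) <= Y.
Proof.
move=> mv FY; pose weight k c := F (delta (phi (k, c))).
have partE g k : F (group_part g v k) = \sum_c weight k c * (v \o q) (g k c).
  rewrite group_part_delta linear_sum; apply: eq_bigr => c _.
  by rewrite linearZ mulrC.
under eq_avg => g.
  rewrite sum_group_part linear_sum; under eq_bigr do rewrite partE.
  over.
apply: avg_sqr_linear_perm.
  by rewrite (avg_comp q_eq) ?avg_mean_zero// -(ltr0n R).
by move=> g; under eq_bigr do rewrite -partE; exact: FY.
Qed.

End RandomCopy.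

Section Variances.
Variables (T : {linear X -> X}) (C : R).
Hypotheses (C0 : 0 <= C) (bT : op_bound T C) (L1 : (1 < #|L|)%N).

Let delta (a : atom N) : atom N -> R := fun b => (b == a)%:R.

Definition operator_matrix k c l d : R :=
  pairing (delta (phi (k, c))) (T (block N (delta (phi (l, d))))).

Definition copy_scalar : R := mean_scalar operator_matrix.

Variables (U : finType) (q : L -> U).
Hypothesis q_eq : equidistributed q.
Variables w v : U -> R.
Hypotheses (mw : mean_zero w) (mv : mean_zero v).
Hypotheses (w1 : forall u, `|w u| <= 1) (v1 : forall u, `|v u| <= 1).
Implicit Types g : sample.
Local Notation form := (block_form operator_matrix (w \o q) (v \o q)).
Local Notation rho g := (random_copy q g).

Let qL0 : (0 < #|L|)%N. Proof. exact: ltnW. Qed.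

Let mwq : mean_zero (w \o q). Proof. exact: mean_zero_comp. Qed.
Let mvq : mean_zero (v \o q). Proof. exact: mean_zero_comp. Qed.

Let avg_wq_vq : avg (fun c => (w \o q) c * (v \o q) c) = avg (fun u => w u * v u).
Proof. exact: (avg_comp q_eq qL0 (fun u => w u * v u)). Qed.

Let bT_part g l : `|T (block N (group_part q g v l))| <= C / root_card.
Proof. by apply: le_trans (bT _) _; rewrite ler_wpM2l// norm_block_group_part. Qed.

Lemma block_form_pairing g k l : form k l (g k) (g l) =
  pairing (group_part q g w k) (T (block N (group_part q g v l))).
Proof.
rewrite /block_form -/(dual_pairing p1 S N _ (group_part q g w k)).
rewrite (group_part_delta q g w) linear_sum; apply: eq_bigr => c _.
rewrite linearZ/= /dual_pairing (group_part_delta q g v) !linear_sum mulr_sumr.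
by apply: eq_bigr => d _; rewrite !linearZ/= /operator_matrix; ring.
Qed.

Lemma pairing_random_copy g :
  pairing (w \o rho g) (T (block N (v \o rho g))) = \sum_k \sum_l form k l (g k) (g l).
Proof.
rewrite !sum_group_part -/(dual_pairing p1 S N _ _) linear_sum.
apply: eq_bigr => k _; rewrite /= /dual_pairing !linear_sum.
by apply: eq_bigr => l _; rewrite block_form_pairing.
Qed.

Lemma norm_block_form_le g k l : `|form k l (g k) (g l)| <=
  group_norm (T (block N (group_part q g v l))) k.
Proof. by rewrite block_form_pairing; exact: pairing_group_part_le. Qed.

Lemma group_norm_part_le g k l :
  group_norm (T (block N (group_part q g v l))) k <= C / #|K|%:R.
Proof.
apply: le_trans (group_norm_le _ _) _.
apply: le_trans (ler_wpM2l _ (bT_part g l)) _.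
  by rewrite divr_ge0// ltW// root_card_gt0.
by rewrite le_eqVlt; apply/orP; left; apply/eqP; field; rewrite !gt_eqF// root_card_gt0.
Qed.

Lemma sum_sqr_block_form_le g :
  \sum_k \sum_l form k l (g k) (g l) ^+ 2 <= C ^+ 2 / root_card.
Proof.
rewrite pair_bigA/=.
have -> : C ^+ 2 / root_card = C / #|K|%:R * (#|K|%:R * (C / root_card)).
  by field; rewrite !gt_eqF// root_card_gt0.
apply: (ler_sum_sqr (q := fun kl => group_norm (T (block N (group_part q g v kl.2))) kl.1)).
- by move=> [k l]; exact: norm_block_form_le.
- by move=> [k l]; exact: group_norm_part_le.
- by rewrite divr_ge0// ltW.
rewrite -(pair_bigA _ (fun k l => group_norm (T (block N (group_part q g v l))) k))/=.
rewrite exchange_big mulr_natl -sumr_const; apply: ler_sum => l _.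
exact: le_trans (sum_group_norm_le _) (bT_part g l).
Qed.

Lemma self_variance :
  avg (fun g => (pairing (w \o rho g) (T (block N (v \o rho g)))
    - copy_scalar * avg (fun u => w u * v u)) ^+ 2) <= 6 * (C ^+ 2 / root_card).
Proof.
apply: le_trans (variance_block_form L1 mwq mvq sum_sqr_block_form_le).
by apply: le_avg => g; rewrite pairing_random_copy avg_wq_vq.
Qed.

Lemma norm_copy_scalar_le : `|copy_scalar * avg (fun u => w u * v u)| <= C.
Proof.
rewrite -avg_wq_vq -(avg_diag_block_form L1 operator_matrix _ mvq).
apply: le_trans (ler_norm_sum _ _ _) _.
have -> : C = \sum_(k : K) C / #|K|%:R.
  by rewrite sumr_const -[RHS]mulr_natl mulrCA mulfV ?mulr1// gt_eqF.
apply: ler_sum => k _; apply: le_trans (ler_norm_avg _) _.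
apply: avg_le_cst card_perms_gt0 _ => sg.
have := le_trans (norm_block_form_le [ffun=> sg] k k) (group_norm_part_le _ k k).
by rewrite !ffunE.
Qed.

Lemma target_variance x : `|x| <= C ->
  avg (fun g => pairing (w \o rho g) x ^+ 2) <= C ^+ 2 * (root_card / #|K|%:R).
Proof.
move=> xC; have -> : C ^+ 2 * (root_card / #|K|%:R) = root_card / #|K|%:R * C * C by ring.
have c0 : 0 <= root_card / #|K|%:R by rewrite divr_ge0// ltW// root_card_gt0.
apply: (avg_sqr_functional q_eq (F := dual_pairing p1 S N x)) => // g.
apply: (ler_sum_sqr (q := group_norm x)).
- by move=> k; exact: pairing_group_part_le.
- by move=> k; apply: le_trans (group_norm_le _ _) _; rewrite ler_wpM2l.
- by rewrite mulr_ge0.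
- exact: le_trans (sum_group_norm_le x) xC.
Qed.

Lemma source_variance N' (w' : atom N' -> R) : (forall a, `|w' a| <= 1) ->
  avg (fun g => pairing w' (T (block N (v \o rho g))) ^+ 2) <= C ^+ 2 / root_card.
Proof.
move=> w'1; have -> : C ^+ 2 / root_card = C / root_card * C by ring.
pose F : {scalar (atom N -> R)} := pairing w' \o T \o block N.
have F_le f : `|F f| <= C * `|block N f| by exact: le_trans (pairing_le _ _ _ w'1) (bT _).
apply: (avg_sqr_functional q_eq (F := F)) => // g.
apply: (ler_sum_sqr (q := fun l => `|F (group_part q g v l)|)) => //.
- by move=> l; apply: le_trans (F_le _) _; rewrite ler_wpM2l// norm_block_group_part.
- by rewrite divr_ge0// ltW// root_card_gt0.
(* the signs turn the sum of the moduli into the value of [F] at one function *)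
pose sg l := Num.sg (F (group_part q g v l)).
pose f := \sum_l sg l *: group_part q g v l.
have -> : \sum_l `|F (group_part q g v l)| = F f.
  rewrite linear_sum; apply: eq_bigr => l _.
  by rewrite linearZ normrEsg.
have mf : mean_zero f.
  rewrite /mean_zero /f; under eq_bigr do rewrite fct_sumE.
  rewrite exchange_big big1//= => l _; rewrite -mulr_sumr.
  by rewrite (group_part_mean_zero q_eq g l mv) mulr0.
have f1 a : `|f a| <= 1.
  rewrite /f fct_sumE (bigD1 (psi a).1)//= big1 ?addr0; last first.
    by move=> l; rewrite fctE /group_part eq_sym => /negbTE ->; rewrite scaler0.
  rewrite fctE normrM -[leRHS]mulr1 ler_pM// ?norm_group_part_le1//.
  by rewrite normr_sg; case: eqP.
apply: le_trans (ler_norm _) _; apply: le_trans (F_le _) _.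
by rewrite ler_piMr// norm_block_le.
Qed.

End Variances.

End GroupedBlock.

Arguments root_card {R} p K.

(** * Choice of the copies and factorization *)

Section CardBij.
Variables (T U : finType) (cardTU : #|T| = #|U|).

Definition card_bij (x : T) : U := enum_val (cast_ord cardTU (enum_rank x)).

Definition card_bij_inv (y : U) : T := enum_val (cast_ord (esym cardTU) (enum_rank y)).

Lemma card_bijK : cancel card_bij card_bij_inv.
Proof. by move=> x; rewrite /card_bij_inv enum_valK cast_ordK enum_rankK. Qed.

Lemma card_bij_invK : cancel card_bij_inv card_bij.
Proof. by move=> y; rewrite /card_bij enum_valK cast_ordKV enum_rankK. Qed.

End CardBij.

Lemma equidistributed_exists (T U : finType) :
  (#|U| %| #|T|)%N -> exists q : T -> U, equidistributed q.
Proof.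
move=> /dvdnP[n cardT].
have cardTU : #|T| = #|{: U * 'I_n}| by rewrite card_prod card_ord mulnC.
exists (fun x => (card_bij cardTU x).1) => u; rewrite cardT; congr (_ * _)%N.
have finj : injective (fun i : 'I_n => card_bij_inv cardTU (u, i)).
  by move=> i i' /(can_inj (card_bij_invK cardTU))[].
rewrite -[RHS](card_ord n) -(card_codom finj).
apply: eq_card => x; rewrite inE; apply/eqP/codomP => [xu|[i ->]].
  by exists (card_bij cardTU x).2; rewrite -xu -surjective_pairing card_bijK.
by rewrite card_bij_invK.
Qed.

Lemma history_choice (X : nat -> Type) (x0 : forall i, X i)
    (P : forall j, (forall i, X i) -> X j -> Prop) :
  (forall j h, exists x, P j h x) ->
  (forall j h h' x, (forall i, (i < j)%N -> h i = h' i) -> P j h x -> P j h' x) ->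
  exists f, forall j, P j f (f j).
Proof.
move=> Pex Pext.
pose F j h := sval (cid (Pex j h)).
have FP j h : P j h (F j h) by exact: svalP (cid (Pex j h)).
pose hist := fix hist n : forall i, X i :=
  if n is n'.+1 then eqtype.dfwith (hist n') (F n' (hist n')) else x0.
pose f j := F j (hist j).
have histE n i : (i < n)%N -> hist n i = f i.
  elim: n => // n IH; rewrite ltnS leq_eqVlt => /orP[/eqP ->|ni] /=.
    by rewrite dfwith_in.
  by rewrite dfwith_out ?IH// gtn_eqF.
exists f => j; apply: Pext (FP j (hist j)) => i ij; exact: histE.
Qed.

Lemma cvg_powR_expn2 {R : realType} (r : R) : 0 < r ->
  (2 ^ m)%:R `^ (- r) @[m --> \oo] --> (0 : R).
Proof.
move=> r0; pose z := 2 `^ (- r) : R.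
have -> : (fun m => (2 ^ m)%:R `^ (- r)) = (fun m => z ^+ m).
  by apply/funext => m; rewrite natrX -[2 ^+ m]powR_mulrn// powRAC powR_mulrn ?powR_ge0.
apply: cvg_expr; rewrite ger0_norm ?powR_ge0// /z powRN invf_lt1 ?powR_gt0//.
apply: (@le_lt_trans _ _ (1 `^ r)); first by rewrite powR1.
by apply: gt0_ltr_powR; rewrite ?nnegrE// ltr1n.
Qed.

Lemma root_card_small {R : realType} (p d : R) : 1 < p -> 0 < d ->
  \forall m \near \oo, (root_card p 'I_(2 ^ m))^-1 + root_card p 'I_(2 ^ m) / (2 ^ m)%:R < d.
Proof.
move=> p1 d0; have pV0 : 0 < p^-1 by rewrite invr_gt0 (lt_trans _ p1).
have pV1 : 0 < 1 - p^-1 by rewrite subr_gt0 invf_lt1// (lt_trans _ p1).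
have : (2 ^ m)%:R `^ (- p^-1) + (2 ^ m)%:R `^ (- (1 - p^-1)) @[m --> \oo] --> (0 : R).
  by rewrite -[0 in X in _ --> X]addr0; apply: cvgD; exact: cvg_powR_expn2.
move=> /cvgrPdist_lt/(_ _ d0); apply: filterS => m; rewrite /= sub0r normrN.
move=> /(le_lt_trans (ler_norm _)); apply: le_lt_trans.
rewrite /root_card card_ord powRN lerD2l opprB powRB ?powRr1//.
by rewrite pnatr_eq0 expn_eq0 implybT.
Qed.

Lemma cluster_near {R : realType} (x : nat -> R) (l e : R) (P : nat -> Prop) :
  cluster (x @ \oo) l -> 0 < e -> (\forall m \near \oo, P m) ->
  exists2 m, P m & `|l - x m| < e.
Proof.
move=> xl e0 nP; have /xl : (x @ \oo) (x @` [set m | P m]).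
  by apply: filterS nP => m Pm; exists m.
move=> /(_ _ (nbhsx_ballx l e e0))[_ [[m Pm <-]]].
by rewrite -ball_normE; exists m.
Qed.

Section Selection.
Context {R : realType} {p : R} (p1 : 1 < p).
Context {X : completeNormedModType R} (S : block_system p X).
Variables (T : {linear X -> X}) (C : R).
Hypotheses (C0 : 0 <= C) (bT : op_bound T C).
Local Notation block := (block S).
Local Notation pairing := (pairing p1 S).

Lemma card_groups m : #|{: 'I_(2 ^ m) * atom m}| = #|{: atom (2 * m)}|.
Proof. by rewrite card_prod !card_ord -expnD mul2n -addnn addnS. Qed.

Definition stage_scalar m : R := copy_scalar p1 S (card_bij (card_groups m)) T.

Let card_atom_gt1 m : (1 < #|{: atom m}|)%N.
Proof. by rewrite card_ord expnS -{1}[2%N]muln1 leq_pmul2l// expn_gt0. Qed.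

Let level_exists m j : (j <= m)%N -> exists q : atom m -> atom j, equidistributed q.
Proof. by move=> jm; apply: equidistributed_exists; rewrite !card_ord dvdn_exp2l. Qed.

Lemma norm_stage_scalar_le m : `|stage_scalar m| <= C.
Proof.
have [q q_eq] := level_exists (leq0n m).
pose sg (a : atom 0) : R := (-1) ^+ a.
have sg0 : mean_zero sg by rewrite /mean_zero !big_ord_recl big_ord0 /sg/=; ring.
have sg1 a : `|sg a| <= 1 by rewrite normrX normrN1 expr1n.
have sgsg : avg (fun a => sg a * sg a) = 1.
  by apply: avg_eq_cst => [|a]; rewrite ?card_atom_gt0// -expr2 sqrr_sign.
have := norm_copy_scalar_le p1 S (card_bijK (card_groups m)) (card_bij_invK _)
  C0 bT (card_atom_gt1 m) q_eq sg0 sg1 sg1.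
by rewrite sgsg mulr1.
Qed.

Record block_copy j := BlockCopy { copy_pos : nat; copy_map :> atom copy_pos -> atom j }.

Section NewCopy.
Variables (j : nat) (J : finType) (x : J -> X) (n : J -> nat).
Variable w : forall i, atom (n i) -> R.
Arguments w : clear implicits.
Hypotheses (xC : forall i, `|x i| <= C) (w1 : forall i a, `|w i a| <= 1).

Local Notation index := ((J * atom j) + (J * atom j) + (atom j * atom j))%type.

Definition stage_copy m (q : atom m -> atom j) :
    {ffun 'I_(2 ^ m) -> {perm (atom m)}} -> atom (2 * m) -> atom j :=
  random_copy (card_bij_inv (card_groups m)) q.

Definition copy_defect m (q : atom m -> atom j) (i : index) g : R :=
  let rho := stage_copy q g in
  match i with
  | inl (inl (i, b)) => pairing (cdelta b \o rho) (x i)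
  | inl (inr (i, b)) => pairing (w i) (T (block _ (cdelta b \o rho)))
  | inr (b, b') => pairing (cdelta b' \o rho) (T (block _ (cdelta b \o rho)))
      - stage_scalar m * avg (fun u => cdelta b' u * cdelta b u)
  end.

Lemma avg_sqr_copy_defect_le m (q : atom m -> atom j) i : equidistributed q ->
  avg (fun g => copy_defect q i g ^+ 2) <=
    6 * C ^+ 2 * ((root_card p 'I_(2 ^ m))^-1 + root_card p 'I_(2 ^ m) / (2 ^ m)%:R).
Proof.
move=> q_eq; set k1 := _^-1; set k2 := _ / _.
have Ck1 : 0 <= C ^+ 2 * k1 by rewrite mulr_ge0 ?sqr_ge0// invr_ge0 powR_ge0.
have Ck2 : 0 <= C ^+ 2 * k2 by rewrite mulr_ge0 ?sqr_ge0// divr_ge0// powR_ge0.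
have gK := card_bijK (card_groups m); have gVK := card_bij_invK (card_groups m).
have mcdelta (b : atom j) := cdelta_mean_zero (R := R) b.
case: i => [[[i b]|[i b]]|[b b']].
- have := target_variance p1 S gK gVK C0 q_eq (mcdelta b) (norm_cdelta_le1 b) (xC i).
  by rewrite [X in _ / X%:R]card_ord -/k2 => /le_trans; apply; lra.
- have := source_variance p1 S gK gVK C0 bT q_eq (mcdelta b) (norm_cdelta_le1 b) (w1 (i := i)).
  by rewrite -/k1 => /le_trans; apply; lra.
- have := self_variance p1 S gK gVK C0 bT (card_atom_gt1 m) q_eq (mcdelta b')
    (mcdelta b) (norm_cdelta_le1 b') (norm_cdelta_le1 b).
  by rewrite -/k1 => /le_trans; apply; lra.
Qed.

Lemma copy_with_small_defects (n0 : nat) (eta lam : R) : 0 < eta ->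
  cluster (stage_scalar @ \oo) lam ->
  exists m, [/\ (j <= m)%N, (n0 <= m)%N, `|lam - stage_scalar m| < eta &
    exists (q : atom m -> atom j) g, equidistributed q /\
      forall i, `|copy_defect q i g| <= eta].
Proof.
move=> eta0 lam_cluster; pose c0 := #|{: index}|%:R * (6 * C ^+ 2) : R.
have c00 : 0 <= c0 by rewrite !mulr_ge0// sqr_ge0.
have d0 : 0 < eta ^+ 2 / (c0 + 1) by rewrite divr_gt0 ?exprn_gt0// ltr_wpDl.
have nearm : \forall m \near \oo, [/\ (j <= m)%N, (n0 <= m)%N &
    (root_card p 'I_(2 ^ m))^-1 + root_card p 'I_(2 ^ m) / (2 ^ m)%:R < eta ^+ 2 / (c0 + 1)].
  near=> m; split; near: m; [exact: nbhs_infty_ge..|exact: root_card_small].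
have [m [jm n0m small] lamm] := cluster_near lam_cluster eta0 nearm.
exists m; split => //; have [q q_eq] := level_exists jm.
have [||g gq] := exists_all_small eta0 _ (fun i => avg_sqr_copy_defect_le i q_eq).
- exact: card_sample_gt0.
- rewrite mulrA -/c0; move: small; rewrite ltr_pdivlMr ?ltr_wpDl//.
  move=> /(le_lt_trans _); apply; rewrite [leRHS]mulrC ler_wpM2r ?lerDl//.
  by rewrite addr_ge0 ?divr_ge0 ?invr_ge0 ?powR_ge0.
by exists q, g.
Unshelve. all: by end_near. Qed.

Lemma copy_exists (n0 : nat) (eta lam : R) : 0 < eta ->
  cluster (stage_scalar @ \oo) lam ->
  exists c : block_copy j, [/\ (n0 <= copy_pos c)%N, equidistributed c,
    forall i (b : atom j), `|pairing (cdelta b \o c) (x i)| <= eta,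
    forall i (b : atom j), `|pairing (w i) (T (block _ (cdelta b \o c)))| <= eta
    & forall b b' : atom j, `|pairing (cdelta b' \o c) (T (block _ (cdelta b \o c)))
        - lam * avg (fun u => cdelta b u * cdelta b' u)| <= eta].
Proof.
move=> eta0 lam_cluster; have eta20 : 0 < eta / 2 by rewrite divr_gt0.
have [m [jm n0m lamm [q [g [q_eq gq]]]]] := copy_with_small_defects n0 eta20 lam_cluster.
have half_le (r : R) : `|r| <= eta / 2 -> `|r| <= eta by move=> /le_trans; apply; lra.
exists (BlockCopy (stage_copy q g)); split => /=.
- by apply: leq_trans n0m _; exact: leq_pmull.
- exact: (random_copy_equidistributed (card_bijK _) (card_bij_invK _) q_eq g).
- by move=> i b; exact/half_le/(gq (inl (inl (i, b)))).
- by move=> i b; exact/half_le/(gq (inl (inr (i, b)))).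
move=> b b'; set a := avg _.
have a1 : `|a| <= 1.
  apply: le_trans (ler_norm_avg _) _; apply: avg_le_cst (card_atom_gt0 j) _ => u.
  by rewrite normrM -[leRHS]mulr1 ler_pM// norm_cdelta_le1.
have := gq (inr (b, b')); rewrite /copy_defect.
under [avg (fun u => cdelta b' u * _)]eq_avg do rewrite mulrC; rewrite -/a => diag.
rewrite -(subrK (stage_scalar m * a) (pairing _ _)) -addrA -mulrBl.
apply: le_trans (ler_normD _ _) _; rewrite normrM [`|_ - lam|]distrC.
have : `|lam - stage_scalar m| * `|a| <= eta / 2 * 1 by apply: ler_pM => //; exact: ltW.
by lra.
Qed.

End NewCopy.

Lemma stage_scalar_cluster : exists lam, cluster (stage_scalar @ \oo) lam.
Proof.
have [|lam [_ lam_cluster]] :=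
    @segment_compact R (- C) C (stage_scalar @ \oo) _.
  by exists 0%N => // m _; rewrite /= in_itv/= -ler_norml norm_stage_scalar_le.
by exists lam.
Qed.

Let tolerance_gt0 i j : 0 < tolerance i j :> R.
Proof. by rewrite /tolerance invr_gt0 !mulr_gt0 ?exprn_gt0 ?ltr0n ?card_atom_gt0. Qed.

Let tolerance_le i j : (i <= j)%N -> tolerance j j <= tolerance i j :> R.
Proof.
move=> ij; rewrite lef_pV2 ?posrE ?(mulr_gt0, exprn_gt0, ltr0n, card_atom_gt0)//.
rewrite !ler_pM ?mulr_ge0 ?exprn_ge0// ?ler_eXn2l ?ltr1n//.
by rewrite !card_ord ler_nat leq_exp2l.
Qed.

Let toleranceC i j : tolerance i j = tolerance j i :> R.
Proof. by rewrite /tolerance [2 ^+ i * _]mulrC [#|{: atom i}|%:R * _]mulrC. Qed.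

Definition compatible_copy lam j (h : forall i, block_copy i) (c : block_copy j) : Prop :=
  [/\ (\sum_(i < j) (copy_pos (h i)).+1 <= copy_pos c)%N, equidistributed c,
    forall (i : 'I_j) (a : atom i) (b : atom j),
      `|pairing (cdelta b \o c) (T (block _ (cdelta a \o h i)))| <= tolerance j j,
    forall (i : 'I_j) (a : atom i) (b : atom j),
      `|pairing (cdelta a \o h i) (T (block _ (cdelta b \o c)))| <= tolerance j j
    & forall b b' : atom j, `|pairing (cdelta b' \o c) (T (block _ (cdelta b \o c)))
        - lam * avg (fun u => cdelta b u * cdelta b' u)| <= tolerance j j].
Arguments compatible_copy : clear implicits.

Lemma compatible_copy_exists lam j (h : forall i, block_copy i) :
  cluster (stage_scalar @ \oo) lam ->
  (forall i, (i < j)%N -> equidistributed (h i)) -> exists c, compatible_copy lam j h c.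
Proof.
move=> lam_cluster h_eq.
have image_le (i : {i : 'I_j & atom i}) :
    `|T (block _ (cdelta (tagged i) \o h (tag i)))| <= C.
  apply: le_trans (bT _) _; rewrite ler_piMr//; apply: norm_block_le => //.
    apply: mean_zero_comp => //; [exact: h_eq|exact: card_atom_gt0|exact: cdelta_mean_zero].
  by move=> a; exact: norm_cdelta_le1.
have [c [c_pos c_eq target source self]] := copy_exists j image_le
  (fun (i : {i : 'I_j & atom i}) a => norm_cdelta_le1 (tagged i) (h (tag i) a))
  (\sum_(i < j) (copy_pos (h i)).+1) (tolerance_gt0 j j) lam_cluster.
exists c; split => // i a b; first exact: target (Tagged _ a) b.
exact: source (Tagged _ a) b.
Qed.

Lemma compatible_copy_ext lam j h h' c : (forall i, (i < j)%N -> h i = h' i) ->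
  compatible_copy lam j h c -> compatible_copy lam j h' c.
Proof.
move=> hh' [c_pos c_eq target source self]; split => // [|i a b|i a b].
- by under eq_bigr do rewrite -hh'//.
- by rewrite -hh'.
- by rewrite -hh'.
Qed.

Lemma copies_exist lam : cluster (stage_scalar @ \oo) lam ->
  exists c : forall j, block_copy j, [/\ {homo (fun n => copy_pos (c n)) : i j / (i < j)%N},
    forall j, equidistributed (c j),
    forall i (b b' : atom i),
      `|pairing (cdelta b' \o c i) (T (block _ (cdelta b \o c i)))
        - lam * avg (fun u => cdelta b u * cdelta b' u)| <= tolerance i i &
    forall i j (b : atom i) (b' : atom j), i != j ->
      `|pairing (cdelta b' \o c j) (T (block _ (cdelta b \o c i)))| <= tolerance i j].
Proof.
move=> lam_cluster.
have [j h|j h h' c hh' hc h'_eq|c cP] := @history_choice _ (fun i => @BlockCopy i i id)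
    (fun j h c => (forall i, (i < j)%N -> equidistributed (h i)) -> compatible_copy lam j h c).
- have [h_eq|nh_eq] := pselect (forall i, (i < j)%N -> equidistributed (h i)).
    by have [c hc] := compatible_copy_exists lam_cluster h_eq; exists c.
  by exists (@BlockCopy j j id) => /nh_eq.
- by apply: (compatible_copy_ext hh') (hc _) => i ij; rewrite hh'//; exact: h'_eq.
have c_eq j : equidistributed (c j).
  by elim/ltn_ind: j => j IH; have [] := cP j IH.
have {}cP j : compatible_copy lam j c (c j) by exact: cP.
exists c; split => [i j ij|//|i b b'|i j b b' ij].
- have [+ _ _ _ _] := cP j; apply: leq_trans.
  by rewrite (bigD1 (Ordinal ij))//= leq_addr.
- by have [_ _ _ _] := cP i; exact.
have [ji|ij'] := ltnP j i.
  rewrite toleranceC; apply: le_trans (tolerance_le (ltnW ji)).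
  by have [_ _ _ /(_ (Ordinal ji) b' b)] := cP i.
have {}ij : (i < j)%N by rewrite ltn_neqAle ij.
apply: le_trans (tolerance_le ij').
by have [_ _ /(_ (Ordinal ij) b b')] := cP j.
Qed.

Lemma scalar_compression : exists (A B : {linear X -> X}) (lam : R),
  [/\ op_bound A 1, op_bound B 1, forall x, A (B x) = x &
    forall x, `|A (T (B x)) - lam *: x| <= 4^-1 * `|x|].
Proof.
have [lam /copies_exist[c [c_incr c_eq diag offdiag]]] := stage_scalar_cluster.
exists (project p1 S c_incr c_eq), (embed p1 S c_incr c_eq), lam; split.
- exact: project_bound.
- exact: embed_bound.
- exact: project_embed.
- exact: (compression_almost_scalar bT c_incr c_eq diag offdiag).
Qed.

End Selection.

Lemma invert_almost_scalar {R : realType} {X : completeNormedModType R}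
    (A U B : {linear X -> X}) (mu : R) :
  2^-1 <= `|mu| -> op_bound A 1 ->
  (forall x, `|A (U (B x)) - mu *: x| <= 4^-1 * `|x|) ->
  exists2 A' : {linear X -> X}, op_bound A' 4 & forall x, A' (U (B x)) = x.
Proof.
move=> mu2 bA AUB; have mu0 : 0 < `|mu| by apply: lt_le_trans mu2; rewrite invr_gt0.
have muN0 : mu != 0 by rewrite -normr_gt0.
have muV : `|mu|^-1 <= 2 by rewrite -[leRHS]invrK lef_pV2 ?posrE ?invr_gt0.
pose E : {linear X -> X} := mu^-1 \*: (A \o U \o B) \- idfun.
have bE : op_bound E 2^-1.
  move=> x; have -> : E x = mu^-1 *: (A (U (B x)) - mu *: x).
    by rewrite scalerBr scalerA mulVf// scale1r.
  rewrite normrZ normfV; apply: le_trans (ler_wpM2l _ (AUB x)) _; first by rewrite invr_ge0.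
  by rewrite mulrA ler_wpM2r//; lra.
have [|W bW WE] := neumann _ bE; first by lra.
exists (W \o (mu^-1 \*: A)).
  move=> x /=; apply: le_trans (bW _) _; rewrite normrZ normfV.
  have := bA x; have := ler_wpM2r (normr_ge0 (A x)) muV.
  rewrite (_ : (1 - 2^-1)^-1 = 2 :> R); last by field.
  by lra.
move=> x /=; rewrite -[RHS]WE; congr (W _).
by rewrite /E/= addrC subrK.
Qed.

Lemma factor_or_complement {R : realType} (p : R) (X : completeNormedModType R)
    (S : block_system p X) (T : {linear X -> X}) (C : R) :
  1 < p -> op_bound T C ->
  exists U A B : {linear X -> X}, [/\ U =1 T \/ U =1 (fun x => x - T x),
    op_bound A 4, op_bound B 1 & forall x, A (U (B x)) = x].
Proof.
move=> p1 bT; have C0 : op_bound T `|C|.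
  by move=> x; apply: le_trans (bT x) _; rewrite ler_wpM2r// ler_norm.
have [A [B [lam [bA bB AB almost]]]] := scalar_compression p1 S (normr_ge0 C) C0.
have [lam2|lam2] := leP 2^-1 `|lam|.
  have [A' bA' A'TB] := invert_almost_scalar lam2 bA almost.
  by exists T, A', B; split => //; left.
have mu2 : 2^-1 <= `|1 - lam|.
  by have := lerB_dist 1 lam; rewrite normr1; lra.
pose U : {linear X -> X} := idfun \- T.
have almostU x : `|A (U (B x)) - (1 - lam) *: x| <= 4^-1 * `|x|.
  have -> : A (U (B x)) - (1 - lam) *: x = - (A (T (B x)) - lam *: x).
    by rewrite /U/= linearB AB scalerBl scale1r !opprB addrC addrA subrK.
  by rewrite normrN.
have [A' bA' A'UB] := invert_almost_scalar mu2 bA almostU.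
by exists U, A', B; split => //; right.
Qed.

(** * Completeness of the Lebesgue spaces *)

Section LimInf.
Context {R : realType}.
Local Open Scope ereal_scope.

Lemma limn_einf_le (u : (\bar R)^nat) c : (forall n, u n <= c) -> limn_einf u <= c.
Proof.
move=> uc; rewrite limn_einf_lim; apply: lime_le; first exact: is_cvg_einfs.
apply: nearW => n; apply: le_trans (uc n); apply: ereal_inf_lbound.
by exists n => /=.
Qed.

Lemma limn_einf_ge (u : (\bar R)^nat) c :
  (\forall n \near \oo, c <= u n) -> c <= limn_einf u.
Proof.
move=> [n0 _ cu]; rewrite limn_einf_lim; apply: lime_ge; first exact: is_cvg_einfs.
exists n0 => // n /= n0n; apply: le_ereal_inf_tmp => _ [m /= nm <-].
by apply: cu => /=; exact: leq_trans nm.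
Qed.

Lemma subdifferentiable_le_limn_einf (phi : R -> R) (u : R^nat) (l : R) :
  subdifferentiable phi -> u n @[n --> \oo] --> l ->
  (phi l)%:E <= limn_einf (fun n => (phi (u n))%:E).
Proof.
move=> /(_ l)[s phi_ge] ul; apply/lee_addgt0Pr => e e0; rewrite -leeBlDr//.
apply: limn_einf_ge; have s0 : (0 < e / (`|s| + 1))%R by rewrite divr_gt0// ltr_wpDl.
move/cvgrPdist_le : ul => /(_ _ s0); apply: filterS => n lu.
rewrite -EFinB lee_fin; apply: le_trans (phi_ge (u n)); rewrite lerD2l.
rewrite -[(u n - l)%R]opprB mulrN lerN2; apply: le_trans (ler_norm _) _; rewrite normrM.
apply: (le_trans (ler_wpM2l (normr_ge0 s) lu)).
by rewrite mulrCA ger_pMr// ler_pdivrMr ?ltr_wpDl// mul1r lerDl.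
Qed.

End LimInf.

Section Lebesgue.
Context d (T : measurableType d) (R : realType) (mu : {measure set T -> \bar R}).
Variable p : R.
Hypothesis p1 : (1 < p)%R.
Implicit Types f g : T -> R.
Local Notation Np f := (Lnorm mu p%:E (EFin \o f)).
Local Open Scope ereal_scope.

Let p0 : (0 < p)%R. Proof. exact: lt_trans ltr01 p1. Qed.

Lemma measurable_norm_powR f : measurable_fun setT f ->
  measurable_fun setT (fun x => (`|f x| `^ p)%:E).
Proof.
move=> mf; apply/measurable_EFinP.
apply: (@measurableT_comp _ _ _ _ _ _ (fun x : R => x `^ p)%R) => //.
exact: measurableT_comp.
Qed.

Lemma Lnorm_le_powR f c : (0 <= c)%R ->
  \int[mu]_x (`|f x| `^ p)%:E <= (c `^ p)%:E -> Np f <= c%:E.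
Proof.
move=> c0; rewrite (_ : \int[mu]_x _ = Np f `^ p); last first.
  by rewrite powR_Lnorm// gt_eqF.
rewrite -poweR_EFin => powle.
have : (Np f `^ p) `^ p^-1 <= (c%:E `^ p) `^ p^-1.
  apply: gt0_ler_poweR => //; first by rewrite invr_ge0 ltW.
  - by rewrite in_itv/= leey poweR_ge0.
  - by rewrite in_itv/= leey lee_fin powR_ge0.
by rewrite -!poweRrM mulfV ?gt_eqF// !poweRe1// ?lee_fin// Lnorm_ge0.
Qed.

Lemma Lnorm_scale f (a : R) : measurable_fun setT f ->
  Np (a \*: f)%R = `|a|%:E * Np f.
Proof.
move=> mf; rewrite unlock/=.
under eq_integral do rewrite normrM powRM// EFinM.
rewrite ge0_integralZl_EFin ?powR_ge0//; last exact: measurable_norm_powR.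
rewrite poweRM ?lee_fin ?powR_ge0 ?integral_ge0//.
by rewrite poweR_EFin -powRrM mulfV ?gt_eqF// powRr1.
Qed.

Lemma eq_ae_Lnorm f g : measurable_fun setT f -> measurable_fun setT g ->
  {ae mu, forall x, f x = g x} -> Np f = Np g.
Proof.
move=> mf mg fg.
suff intE : \int[mu]_x (`|f x| `^ p)%:E = \int[mu]_x (`|g x| `^ p)%:E.
  by rewrite unlock/= intE.
apply: ge0_ae_eq_integral => //; [exact: measurable_norm_powR..|].
by apply: filterS fg => x fgx _; rewrite /= fgx.
Qed.

Lemma Lnorm_eq0 f : measurable_fun setT f -> Np f = 0 -> {ae mu, forall x, f x = 0%R}.
Proof.
move=> /measurable_EFinP mf /(Lnorm_eq0_eq0 mf); rewrite lte_fin => /(_ p0).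
by apply: filterS => x /(_ I)[].
Qed.

Lemma Lnorm_le_of_ae_cvg (f : nat -> T -> R) g (c : R) : (0 <= c)%R ->
  (forall n, measurable_fun setT (f n)) -> measurable_fun setT g ->
  {ae mu, forall t, f n t @[n --> \oo] --> g t} ->
  (forall n, Np (f n) <= c%:E) -> Np g <= c%:E.
Proof.
move=> c0 mf mg fg fc; apply: Lnorm_le_powR => //.
have mfp n := measurable_norm_powR (mf n).
apply: (@le_trans _ _ (\int[mu]_t limn_einf (fun n => (`|f n t| `^ p)%:E))); last first.
  apply: le_trans (fatou mu measurableT mfp _) _.
    by move=> n t _; rewrite lee_fin powR_ge0.
  apply: limn_einf_le => n; rewrite (_ : \int[mu]_x _ = Np (f n) `^ p); last first.
    by rewrite powR_Lnorm// gt_eqF.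
  rewrite -poweR_EFin gt0_ler_poweR ?in_itv/= ?leey ?lee_fin ?Lnorm_ge0 ?c0//.
  exact: ltW.
apply: ae_ge0_le_integral => //.
- exact: measurable_norm_powR.
- by move=> t _; apply: limn_einf_ge; apply: nearW => n; rewrite lee_fin powR_ge0.
- under eq_fun do rewrite -[limn_einf _]oppeK -limn_esupN.
  apply: measurableT_comp => //; apply: measurable_fun_limn_esup => n.
  exact: measurableT_comp.
apply: filterS fg => t fgt _.
exact: (subdifferentiable_le_limn_einf (subdifferentiable_powR p1) fgt).
Qed.

Lemma ae_cvg_of_summable_increments (x : nat -> T -> R) :
  (forall k, measurable_fun setT (x k)) ->
  (forall k, \int[mu]_t `|x k.+1 t - x k t|%:E <= (2^-1 ^+ k)%:E) ->
  exists2 y : T -> R, measurable_fun setT y &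
    {ae mu, forall t, x n t @[n --> \oo] --> y t}.
Proof.
move=> mx fast; pose dx k t := (x k.+1 t - x k t)%R.
have mdx k : measurable_fun setT (fun t => `|dx k t|%:E).
  by apply/measurable_EFinP; apply: measurableT_comp => //; exact: measurable_funB.
pose s t := \sum_(0 <= k <oo) `|dx k t|%:E.
have s_int : \int[mu]_t s t <= 2%:E.
  rewrite integral_nneseries//.
  apply: lime_le; first by apply: is_cvg_nneseries => n _ _; exact: integral_ge0.
  apply: nearW => n; apply: (@le_trans _ _ (\sum_(0 <= k < n) (2^-1 ^+ k)%:E)).
    by apply: lee_sum => k _; exact: fast.
  by rewrite sumEFin lee_fin big_mkord sum_half_powers_le.
have s_fin : {ae mu, forall t, s t \is a fin_num}.
  have s0 t : 0 <= s t by exact: nneseries_ge0.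
  have : mu.-integrable setT s.
    apply/integrableP; split.
      by apply: (ge0_emeasurable_sum (h := fun k t => `|dx k t|%:E)) => // k _; exact: mdx.
    by under eq_integral do rewrite gee0_abs//; exact: le_lt_trans s_int (ltry _).
  by move/(integrable_ae measurableT); apply: filterS => t; exact.
exists (fun t => fine (limn_esup (fun n => (x n t)%:E))).
  apply: measurableT_comp => //; apply: measurable_fun_limn_esup => n.
  exact/measurable_EFinP.
apply: filterS s_fin => t st.
suff /cvg_ex[l xl] : cvgn (x^~ t).
  have xlE : (x n t)%:E @[n --> \oo] --> l%:E by apply: cvg_EFin; [exact: nearW|exact: xl].
  by rewrite (cvg_limn_einf_sup xlE).2.
rewrite (_ : x^~ t = (fun n => x 0%N t + series (dx^~ t) n)%R); last first.
  by apply/funext => n; rewrite seriesEnat/= telescope_sumr// addrC subrK.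
apply: is_cvgD; first exact: is_cvg_cst.
apply: normed_cvg; apply: nondecreasing_is_cvgn.
  by apply: nondecreasing_series => n _ _; exact: normr_ge0.
exists (fine (s t)) => _ [n _ <-]; rewrite -lee_fin fineK//.
by rewrite /series/= -sumEFin; exact: nneseries_lim_ge.
Qed.

Lemma Lnorm_increments_le (x : nat -> T -> R) : (forall k, measurable_fun setT (x k)) ->
  (forall k, Np (x k.+1 \- x k)%R <= (2^-1 ^+ k)%:E) ->
  forall k n, Np (x (n + k)%N \- x k)%R <= (2 * 2^-1 ^+ k)%:E.
Proof.
move=> mx fast k n.
apply: (@le_trans _ _ (2^-1 ^+ k * \sum_(i < n) 2^-1 ^+ i)%:E); last first.
  by rewrite lee_fin mulrC ler_wpM2r ?exprn_ge0 ?invr_ge0// sum_half_powers_le.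
elim: n => [|n IH].
  rewrite big_ord0 mulr0 (_ : EFin \o _ = cst 0); first by rewrite Lnorm0// eqe gt_eqF.
  by apply/funext => t; rewrite /= subrr.
have -> : (x (n.+1 + k)%N \- x k = (x (n + k)%N \- x k) \+ (x (n + k).+1 \- x (n + k)%N))%R.
  by apply/funext => t; rewrite /= addSn; ring.
apply: le_trans (minkowski_EFin _ _ _ _) _; [exact: measurable_funB..|exact: ltW|].
by rewrite big_ord_recr/= mulrDr EFinD -exprD addnC leeD// addnC.
Qed.

Lemma Lnorm1_le_Lnorm f : mu setT = 1 -> measurable_fun setT f ->
  \int[mu]_x `|f x|%:E <= Np f.
Proof.
move=> mu1 mf; have q0 : (0 < p / (p - 1))%R by rewrite divr_gt0// subr_gt0.
have pq : (p^-1 + (p / (p - 1))^-1 = 1)%R.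
  by rewrite invf_div; field; rewrite gt_eqF.
have := hoelder mu mf (measurable_cst (1%R : R)) p0 q0 pq.
rewrite Lnorm1 (_ : Lnorm mu (p / (p - 1))%:E _ = 1); last first.
  by rewrite (_ : EFin \o cst 1%R = cst 1)// Lnorm_cst1 mu1 poweR1r.
rewrite mule1; apply: le_trans.
by under [leRHS]eq_integral do rewrite /= mulr1.
Qed.

Lemma Lnorm_complete (x : nat -> T -> R) : mu setT = 1 ->
  (forall k, measurable_fun setT (x k)) ->
  (forall k, Np (x k.+1 \- x k)%R <= (2^-1 ^+ k)%:E) ->
  exists2 y : T -> R, measurable_fun setT y &
    forall k, Np (y \- x k)%R <= (2 * 2^-1 ^+ k)%:E.
Proof.
move=> mu1 mx fast; have [|y my xy] := ae_cvg_of_summable_increments mx.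
  move=> k; apply: le_trans (fast k); apply: (Lnorm1_le_Lnorm mu1).
  exact: measurable_funB.
exists y => // k; apply: (Lnorm_le_of_ae_cvg (f := fun n => x (n + k)%N \- x k)%R).
- by rewrite mulr_ge0// exprn_ge0// invr_ge0.
- by move=> n; exact: measurable_funB.
- exact: measurable_funB.
- apply: filterS xy => t; rewrite -(cvg_shiftn k) => xyt.
  by apply: cvgB; [exact: xyt|exact: cvg_cst].
- by move=> n; exact: Lnorm_increments_le.
Qed.

End Lebesgue.

(** * Haar functions on dyadic intervals *)

Section Dyadic.
Context {R : realType}.
Implicit Types (x : R) (n k i a c : nat).

Definition dyadic_index n x : nat := Num.truncn (x * 2 ^+ n).

Definition dyadic_itv n a : interval R := `[a%:R / 2 ^+ n, a.+1%:R / 2 ^+ n[.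

(* The value of a Haar function with index [(k, i)] on the [c]-th dyadic
   interval of length [2^-(k+1)]; it does not depend on [k]. *)
Definition haar_sign i c : R := (c == 2 * i)%N%:R - (c == 2 * i + 1)%N%:R.

(* Likewise on the [a]-th dyadic interval of length [2^-n], for [k < n]. *)
Definition haar_value n k i a : R := haar_sign i (a %/ 2 ^ (n - k.+1)).

Lemma dyadic_index_eq n a x : 0 <= x -> (dyadic_index n x == a) = (x \in dyadic_itv n a).
Proof.
move=> x0; rewrite /dyadic_index truncn_eq ?mulr_ge0 ?exprn_ge0//.
by rewrite in_itv/= ler_pdivrMr// ltr_pdivlMr.
Qed.

Lemma haar_dyadic_index k i x : 0 <= x ->
  haar k i x = haar_sign i (dyadic_index k.+1 x).
Proof.
move=> x0; rewrite /haar /haar_sign !dyadic_index_eq// !indicE !mem_setE !in_itv/=.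
have scale m : m%:R / 2 ^+ k = (2 * m)%:R / 2 ^+ k.+1 :> R.
  by rewrite natrM exprS invfM mulrACA mulfV// mul1r.
have -> : (2 * i).+1 = (2 * i + 1)%N by rewrite addn1.
have -> : (2 * i + 1).+1 = (2 * i.+1)%N by rewrite mulnS addn1.
by rewrite -!scale.
Qed.

Lemma dyadic_index_div n k x : 0 <= x -> (k <= n)%N ->
  dyadic_index k x = (dyadic_index n x %/ 2 ^ (n - k))%N.
Proof.
move=> x0 kn; apply/eqP; rewrite dyadic_index_eq//.
have /eqP := erefl (dyadic_index n x); rewrite dyadic_index_eq// !in_itv/=.
set a := dyadic_index n x; set m := (2 ^ (n - k))%N.
have m0 : (0 < m)%N by rewrite expn_gt0.
rewrite !ler_pdivrMr// !ltr_pdivlMr//.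
have -> : 2 ^+ n = 2 ^+ k * m%:R :> R by rewrite natrX -exprD subnKC.
rewrite mulrA => /andP[ax xa]; apply/andP; split.
  rewrite -(ler_pM2r (x := m%:R)) ?ltr0n// -natrM; apply: le_trans ax.
  by rewrite ler_nat leq_divM.
rewrite -(ltr_pM2r (x := m%:R)) ?ltr0n// -natrM; apply: lt_le_trans xa _.
by rewrite ler_nat ltn_ceil.
Qed.

Lemma haar_dyadic_itv n k i a x : (k < n)%N -> 0 <= x -> x \in dyadic_itv n a ->
  haar k i x = haar_value n k i a.
Proof.
move=> kn x0; rewrite -dyadic_index_eq// => /eqP <-.
by rewrite haar_dyadic_index// (dyadic_index_div x0 kn).
Qed.

Lemma haar_sign_bit i j b : (b <= 1)%N ->
  haar_sign i (2 * j + b) = (i == j)%:R * (-1) ^+ b.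
Proof.
rewrite /haar_sign => b1.
have -> : (2 * j + b == 2 * i)%N = (i == j) && (b == 0%N) by lia.
have -> : (2 * j + b == 2 * i + 1)%N = (i == j) && (b == 1%N) by lia.
case: b b1 => [|[|//]] _; case: eqP => _ /=; ring.
Qed.

Let divn2_bit a : a = (2 * (a %/ 2) + a %% 2)%N. Proof. by rewrite mulnC -divn_eq. Qed.

Let modn2_le1 a : (a %% 2 <= 1)%N. Proof. by rewrite -ltnS ltn_mod. Qed.

Lemma haar_sign_inj a c :
  haar_sign (a %/ 2) c = haar_sign (a %/ 2) a -> c = a.
Proof.
rewrite [X in _ = haar_sign _ X -> _](divn2_bit a) haar_sign_bit// eqxx mul1r /haar_sign => ca.
rewrite (divn2_bit a); move: ca; set i := (a %/ 2)%N.
have : (a %% 2 = 0 \/ a %% 2 = 1)%N by have := modn2_le1 a; lia.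
case=> ->; rewrite ?addn0 ?expr0 ?expr1.
  by case: (c =P (2 * i)%N) => // _; case: eqP => _ /= ca; exfalso; lra.
by case: (c =P (2 * i + 1)%N) => // _; case: eqP => _ /= ca; exfalso; lra.
Qed.

Lemma sum_haar_value n k i : (k < n)%N -> (i < 2 ^ k)%N ->
  \sum_(a < 2 ^ n) haar_value n k i a = 0.
Proof.
move=> kn ik; have -> : (2 ^ n = 2 ^ k.+1 * 2 ^ (n - k.+1))%N by rewrite -expnD subnKC.
rewrite -(big_mkord xpredT) big_nat_mul/=.
have m0 : (0 < 2 ^ (n - k.+1))%N by rewrite expn_gt0.
rewrite (eq_bigr (fun j => (2 ^ (n - k.+1))%:R * haar_sign i j)); last first.
  move=> j _; transitivity (\sum_(j * 2 ^ (n - k.+1) <= a < j.+1 * 2 ^ (n - k.+1)) haar_sign i j).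
    apply: eq_big_nat => a /andP[ja aj]; congr haar_sign.
    by apply/eqP; rewrite eqn_leq leq_divRL// ja andbT -ltnS ltn_divLR.
  by rewrite sumr_const_nat -mulnBl subSnn mul1n mulr_natl.
rewrite -mulr_sumr big_mkord sumrB.
have sum_eq b : (b < 2 ^ k.+1)%N -> \sum_(j < 2 ^ k.+1) (j == b :> nat)%:R = 1 :> R.
  move=> bk; rewrite -[RHS](sum_delta (fun=> 1) (Ordinal bk)).
  by apply: eq_bigr => j _; rewrite mul1r.
by rewrite !sum_eq ?subrr ?mulr0// expnS; lia.
Qed.

Lemma sum_haar_finest n (c : nat -> R) a : (a < 2 ^ n.+1)%N ->
  \sum_(i < 2 ^ n) c i * haar_value n.+1 n i a = c (a %/ 2)%N * (-1) ^+ (a %% 2).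
Proof.
move=> an; have a2 : (a %/ 2 < 2 ^ n)%N by rewrite ltn_divLR// -expnSr.
rewrite (bigD1 (Ordinal a2))//= big1 ?addr0 /haar_value ?subnn ?expn0 ?divn1.
  by rewrite [X in haar_sign _ X](divn2_bit a) haar_sign_bit// eqxx mul1r.
move=> i; rewrite -val_eqE/= => /negbTE ia.
by rewrite [X in haar_sign _ X](divn2_bit a) haar_sign_bit// ia mul0r mulr0.
Qed.

Lemma haar_expansion n (f : nat -> R) : \sum_(a < 2 ^ n) f a = 0 ->
  exists c : nat -> nat -> R, forall a, (a < 2 ^ n)%N ->
    f a = \sum_(k < n) \sum_(i < 2 ^ k) c k i * haar_value n k i a.
Proof.
elim: n f => [|n IH] f sumf.
  exists (fun _ _ => 0) => a; rewrite expn0 ltnS leqn0 => /eqP ->.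
  by rewrite big_ord0; move: sumf; rewrite big_ord_recl big_ord0 addr0.
pose coarse i := (f (2 * i)%N + f (2 * i + 1)%N) / 2.
pose detail i := (f (2 * i)%N - f (2 * i + 1)%N) / 2.
have [|c cE] := IH coarse.
  rewrite -mulr_suml; apply/eqP; rewrite mulf_eq0; apply/orP; left; apply/eqP.
  rewrite -[RHS]sumf -[RHS](big_mkord xpredT) expnSr big_nat_mul/= big_mkord.
  apply: eq_bigr => i _; rewrite [(i.+1 * 2)%N]mulSnr addn2 [(i * 2)%N]mulnC.
  by rewrite !big_nat_recr ?leqnSn ?leqnn ?(leq_trans (leqnSn _))// big_geq//= add0r addn1.
exists (fun k i => if (k < n)%N then c k i else detail i) => a an.
have a2 : (a %/ 2 < 2 ^ n)%N by rewrite ltn_divLR// -expnSr.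
rewrite big_ord_recr/= ltnn sum_haar_finest//.
have -> : \sum_(k < n) \sum_(i < 2 ^ k)
    (if (k < n)%N then c k i else detail i) * haar_value n.+1 k i a = coarse (a %/ 2)%N.
  rewrite cE//; apply: eq_bigr => k _; apply: eq_bigr => i _.
  by rewrite ltn_ord /haar_value subSn// expnS divnMA.
rewrite [X in f X](divn2_bit a) /coarse /detail.
have : (a %% 2 = 0 \/ a %% 2 = 1)%N by have := modn2_le1 a; lia.
by case=> ->; rewrite ?addn0; field.
Qed.

End Dyadic.

(** * The joint law of the Haar blocks *)

Lemma sigma_algebra_bigcap_nat (T : Type) (D : set T) (G : set (set T))
    (A : nat -> set T) (P : set nat) : sigma_algebra D G ->
  (forall i, P i -> G (D `&` A i)) -> G (D `&` \bigcap_(i in P) A i).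
Proof.
move=> [G0 GC GU] GA.
have -> : D `&` \bigcap_(i in P) A i =
    D `\` \bigcup_i (if `[< P i >] then D `\` (D `&` A i) else set0).
  apply/seteqP; split => x.
    move=> [Dx Ax]; split => // -[i _]; case: asboolP => // Pi [_]; apply; split => //.
    exact: Ax.
  move=> [Dx nx]; split => // i Pi; apply: contrapT => nA; apply: nx.
  exists i => //; rewrite (asboolT Pi); split => // -[_ Ai]; exact: nA.
apply: (GC); apply: GU => i; case: asboolP => // Pi; apply: (GC); exact: GA.
Qed.

Lemma uniq_map_inj (T1 T2 : eqType) (f : T1 -> T2) (s : seq T1) :
  uniq [seq f x | x <- s] -> {in s &, injective f}.
Proof.
move=> us x y xs ys fxy; rewrite -(nth_index x xs) -(nth_index x ys).
congr nth; apply/eqP; rewrite -(nth_uniq (f x) _ _ us) ?size_map ?index_mem//.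
by rewrite !(nth_map x) ?index_mem// !nth_index// fxy.
Qed.

#[export] Instance mu01_ae_filter {R : realType} : Filter (almost_everywhere (@mu01 R)).
Proof. exact: ae_filter_ringOfSetsType. Qed.

Section HaarBlocks.
Context {R : realType} (h : nat -> nat -> nat -> R -> R).
Hypothesis mh : forall n k i, Domega (n, k, i) -> measurable_fun setT (h n k i).
Hypothesis hdist : same_joint_dist h.
Hypothesis hindep : indep_blocks h.
Local Notation mu := (@mu01 R).
Local Notation I01 := (`[(0:R), 1]%classic).

Lemma mu01_setT : mu setT = 1%E.
Proof.
rewrite /mu01/= /mrestr setTI lebesgue_measure_itv/= lte_fin ltr01.
by rewrite oppr0 adde0.
Qed.

Lemma mu01_setI01 A : mu (I01 `&` A) = mu A.
Proof. by rewrite /mu01/= /mrestr setIAC setIid setIC. Qed.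

(* Blocks are numbered from [0]: the [n]-th one is the family [h n.+1], whose
   joint values are those of the Haar functions on the dyadic intervals of
   length [2^-(n+1)]. *)
Definition cell (n a : nat) : set R :=
  \bigcap_(k in [set k | (k < n.+1)%N]) \bigcap_(i in [set i | (i < 2 ^ k)%N])
    (h n.+1 k i @^-1` [set haar_value n.+1 k i a]).

Lemma cell_value n a k i x : cell n a x -> (k <= n)%N -> (i < 2 ^ k)%N ->
  h n.+1 k i x = haar_value n.+1 k i a.
Proof. by move=> cx kn ik; exact: (cx k). Qed.

Lemma half_atom_lt n (a : atom n) : (a %/ 2 < 2 ^ n)%N.
Proof. by rewrite ltn_divLR// -expnSr. Qed.

Lemma cell_inj n (a b : atom n) x : cell n a x -> cell n b x -> a = b.
Proof.
move=> ca cb; apply: val_inj.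
have := cell_value ca (leqnn n) (half_atom_lt a).
rewrite (cell_value cb (leqnn n) (half_atom_lt a)) /haar_value subnn expn0 !divn1.
by move/haar_sign_inj.
Qed.

Lemma measurable_cell n a : measurable (cell n a).
Proof.
apply: bigcap_measurable; first by exists 0%N.
move=> k /= kn; apply: bigcap_measurable; first by exists 0%N; rewrite /= expn_gt0.
move=> i /= ik; rewrite -[X in measurable X]setTI; apply: mh => //.
by rewrite /Domega /= kn ik.
Qed.

Lemma haar_cell_itv n (a : atom n) :
  (\bigcap_(k in [set k | (k < n.+1)%N]) \bigcap_(i in [set i | (i < 2 ^ k)%N])
    (haar k i @^-1` [set haar_value n.+1 k i a])) `&` I01 = [set` dyadic_itv n.+1 a] :> set R.
Proof.
apply/seteqP; split => x /=.
  move=> [hx]; rewrite in_itv/= => /andP[x0 _]; rewrite -dyadic_index_eq//; apply/eqP.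
  have := hx n (ltnSn n) (a %/ 2)%N (half_atom_lt a).
  rewrite /= haar_dyadic_index// /haar_value subnn expn0 divn1.
  exact: haar_sign_inj.
move=> xI; have := xI; rewrite in_itv/= => /andP[x1 x2].
have x0 : 0 <= x by apply: le_trans x1; rewrite divr_ge0// exprn_ge0.
split; first by move=> k /= kn i /= ik; exact: haar_dyadic_itv.
rewrite in_itv/= x0/=; apply: (le_trans (ltW x2)).
by rewrite ler_pdivrMr ?exprn_gt0// mul1r -natrX ler_nat.
Qed.

Lemma mu01_cell n (a : atom n) : mu (cell n a) = (#|{: atom n}|%:R^-1)%:E.
Proof.
rewrite (hdist (ltn0Sn n) (B := fun k i => [set haar_value n.+1 k i a]))//.
rewrite /mu01/= /mrestr haar_cell_itv lebesgue_measure_itv/= lte_fin.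
rewrite ltr_pM2r ?invr_gt0 ?exprn_gt0// ltr_nat ltnSn.
by rewrite -EFinB -mulrBl -natrB// subSnn mul1r card_ord natrX.
Qed.

Lemma gen_sigma_cell n a : gen_sigma h n.+1 (I01 `&` cell n a).
Proof.
have sG := smallest_sigma_algebra I01 [set A | exists k i (B : set R),
  [/\ (k < n.+1)%N, (i < 2 ^ k)%N, measurable B &
   A = I01 `&` (h n.+1 k i @^-1` B)]].
apply: (sigma_algebra_bigcap_nat sG) => k kn.
apply: (sigma_algebra_bigcap_nat sG) => i ik.
by apply: sub_sigma_algebra; exists k, i, [set haar_value n.+1 k i a]; split.
Qed.

Lemma mu01_bigsetI_cells (N : nat -> nat) (y : forall n, atom (N n)) s :
  uniq [seq N n | n <- s] ->
  mu (\big[setI/setT]_(n <- s) cell (N n) (y n)) =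
  (\prod_(n <- s) #|{: atom (N n)}|%:R^-1)%:E.
Proof.
move=> us; pose z m := y (nth 0%N s (index m [seq N n | n <- s])) : nat.
have zE n : n \in s -> z (N n) = y n.
  by move=> ns; rewrite /z nth_index_map//; exact: uniq_map_inj.
pose blocks := [seq (N n).+1 | n <- s].
have ublocks : uniq blocks by rewrite /blocks (map_comp S) map_inj_uniq//; exact: succn_inj.
have blocks_gt0 : all (fun m => (0 < m)%N) blocks by apply/allP => m /mapP[n _ ->].
have := hindep ublocks blocks_gt0 (A := fun m => I01 `&` cell m.-1 (z m.-1)).
rewrite bigcap_seq !big_map => indep.
transitivity (mu (\big[setI/setT]_(n <- s) (I01 `&` cell (N n) (z (N n))))).
  rewrite -mu01_setI01 -[RHS]mu01_setI01 -!bigcap_seq; congr (mu _).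
  apply/seteqP; split => x [Ix cx]; split => // n ns.
    by rewrite zE//; split => //; exact: cx.
  by have [_] := cx n ns; rewrite zE.
rewrite indep; last by move=> m /mapP[n _ ->]; exact: gen_sigma_cell.
rewrite -prodEFin; apply: eq_big_seq => n ns.
by rewrite mu01_setI01 zE// mu01_cell.
Qed.

Definition cells n : set R := \big[setU/set0]_(a : atom n) cell n a.

Lemma measurable_cells n : measurable (cells n).
Proof. by apply: bigsetU_measurable => a _; exact: measurable_cell. Qed.

Lemma trivIset_cell n : trivIset setT (fun a : atom n => cell n a).
Proof. by move=> a b _ _ [x [ca cb]]; exact: cell_inj ca cb. Qed.

Lemma mu01_setC_cells n : mu (~` cells n) = 0%E.
Proof.
have mu_cells : mu (cells n) = 1%E.
  rewrite measure_bigsetU_ord//; last exact: trivIset_cell.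
    rewrite (eq_bigr _ (fun a _ => mu01_cell a)) sumEFin sumr_const -[_ *+ _]mulr_natl.
    by rewrite mulfV// pnatr_eq0 -lt0n card_atom_gt0.
  by move=> a; exact: measurable_cell.
have mcells := measurable_cells n.
have muT : (mu setT < +oo)%E by rewrite mu01_setT ltry.
have muD : mu (setT `\` cells n) = (mu setT - mu (setT `&` cells n))%E by exact: measureD.
by rewrite -setTD muD setTI mu_cells mu01_setT subee.
Qed.

Lemma ae_cells : {ae mu, forall x, exists a : forall n, atom n, forall n, cell n (a n) x}.
Proof.
have ae_cells n : {ae mu, forall x, cells n x}.
  exists (~` cells n); split => //; last exact: mu01_setC_cells.
  exact: measurableC (measurable_cells n).
have := ae_foralln ae_cells; apply: filterS => x cx.
have xcell n : exists a : atom n, cell n a x.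
  by have := cx n; rewrite /cells -bigcup_seq => -[a _]; exists a.
by exists (fun n => sval (cid (xcell n))) => n; exact: svalP (cid (xcell n)).
Qed.

Lemma integral_cells n (E : set R) (phi : R -> \bar R) : measurable E ->
  measurable_fun setT phi -> (forall x, 0 <= phi x)%E ->
  (\int[mu]_(x in E) phi x = \sum_(a : atom n) \int[mu]_(x in E `&` cell n a) phi x)%E.
Proof.
move=> mE mphi phi0.
rewrite (ge0_negligible_integral (mu := mu) (measurableC (measurable_cells n)) mE
  (measurable_funTS mphi) (fun x _ => phi0 x) (mu01_setC_cells n)).
rewrite setDE setCK /cells big_distrr/= ge0_integral_bigsetU//.
- by move=> a; apply: measurableI => //; exact: measurable_cell.
- exact: index_enum_uniq.
- by move=> a b _ _ [x [[_ ca] [_ cb]]]; exact: cell_inj ca cb.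
- exact: measurable_funTS.
Qed.

Definition cell_fun n (f : atom n -> R) : R -> R :=
  fun x => \sum_a f a * \1_(cell n a) x.

Lemma cell_funE n (f : atom n -> R) (a : atom n) x : cell n a x -> cell_fun f x = f a.
Proof.
move=> cx; rewrite /cell_fun (bigD1 a)//= indicE mem_set// mulr1.
rewrite big1 ?addr0// => b ba; rewrite indicE memNset ?mulr0// => cb.
by move: ba; rewrite (cell_inj cb cx) eqxx.
Qed.

Lemma measurable_cell_fun n (f : atom n -> R) : measurable_fun setT (cell_fun f).
Proof.
apply: measurable_sum => a; apply: measurable_funM => //.
by apply: measurable_indic; exact: measurable_cell.
Qed.

Section Law.
Variables (N : nat -> nat) (F : forall n, atom (N n) -> R) (phi : R -> R).
Arguments F : clear implicits.
Hypothesis mphi : measurable_fun setT phi.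
Hypothesis phi0 : forall t, 0 <= phi t.
Local Notation cell_sum s x := (\sum_(n <- s) cell_fun (F n) x).
Local Notation cellI s y := (\big[setI/setT]_(n <- s) cell (N n) (y n)).

(* [E] plays the role of an event determined by blocks which are not in [s]. *)
Lemma integral_cell_sum s (E : set R) (r t : R) : uniq s -> measurable E ->
  (forall s' (y : forall n, atom (N n)), subseq s' s ->
    mu (E `&` cellI s' y) = (r * \prod_(n <- s') #|{: atom (N n)}|%:R^-1)%:E) ->
  (\int[mu]_(x in E) (phi (t + cell_sum s x))%:E = (r * indep_mean phi F s t)%:E)%E.
Proof.
elim: s E r t => [|n s IH] E r t us mE E_indep.
  under eq_integral do rewrite big_nil addr0.
  have zero k : atom (N k) by exact: (Ordinal (expn_gt0 2 _)).
  have := E_indep [::] zero isT; rewrite !big_nil setIT mulr1 => muE.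
  by rewrite integral_cst// muE -EFinM mulrC.
have [nNs us'] := andP us.
have mIcell a : measurable (E `&` cell (N n) a).
  by apply: measurableI => //; exact: measurable_cell.
rewrite (integral_cells (N n) mE); last 2 first.
- apply/measurable_EFinP; apply: measurableT_comp => //.
  apply: measurable_funD => //; apply: measurable_sum => k.
  exact: measurable_cell_fun.
- by move=> x; rewrite lee_fin.
transitivity (\sum_a
    (r / #|{: atom (N n)}|%:R * indep_mean phi F s (t + F n a))%:E)%E; last first.
  by rewrite sumEFin -mulr_sumr -mulrA.
apply: eq_bigr => a _; rewrite -(IH (E `&` cell (N n) a))//.
  apply: eq_integral => x; rewrite inE => -[_ cx].
  by rewrite big_cons (cell_funE _ cx) addrA.
move=> s' y s's; have nNs' : n \notin s' by apply: contra nNs; exact: mem_subseq.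
have ns's : subseq (n :: s') (n :: s) by rewrite /= eqxx.
have := E_indep (n :: s') (eqtype.dfwith y a) ns's.
rewrite !big_cons dfwith_in setIA mulrA => <-; congr (mu (_ `&` _)).
apply: eq_big_seq => k ks'; rewrite dfwith_out//.
by apply: contraNneq nNs' => ->.
Qed.

Lemma law_cell_sum s : uniq [seq N n | n <- s] ->
  (\int[mu]_x (phi (cell_sum s x))%:E = (indep_mean phi F s 0)%:E)%E.
Proof.
move=> us; have := @integral_cell_sum s setT 1 0 (map_uniq us) measurableT.
rewrite mul1r => <-; first by apply: eq_integral => x _; rewrite add0r.
move=> s' y s's; rewrite setTI mul1r mu01_bigsetI_cells//.
by apply: subseq_uniq us; exact: map_subseq.
Qed.

End Law.

End HaarBlocks.

(** * The space spanned by the Haar blocks *)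

Lemma sum_count_mem (R : pzRingType) (I : eqType) (s t : seq I) (F : I -> R) :
  uniq t -> {subset s <= t} ->
  \sum_(i <- t) (count_mem i s)%:R * F i = \sum_(i <- s) F i.
Proof.
move=> ut; elim: s => [|i s IH] st; first by rewrite big_nil big1// => i _; rewrite mul0r.
rewrite big_cons -IH; last by move=> j js; apply: st; rewrite inE js orbT.
rewrite (eq_bigr (fun j => (i == j)%:R * F j + (count_mem j s)%:R * F j)); last first.
  by move=> j _; rewrite /= natrD mulrDl.
rewrite big_split/= (bigD1_seq i)//=; last by apply: st; rewrite inE eqxx.
by rewrite eqxx mul1r big1 ?addr0// => j; rewrite eq_sym => /negbTE ->; rewrite mul0r.
Qed.

Section Centring.
Context {R : realType} (T : finType).
Implicit Types f g : T -> R.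

Definition centre f : T -> R := fun x => f x - avg f.

Lemma centre_mean_zero f : (0 < #|T|)%N -> mean_zero (centre f).
Proof.
move=> T0; rewrite /mean_zero sumrB sumr_const -[X in _ - X]mulr_natl /avg mulrA.
by rewrite mulfV ?mul1r ?subrr// pnatr_eq0 -lt0n.
Qed.

Lemma centre_id f : mean_zero f -> centre f = f.
Proof. by move=> f0; apply/funext => x; rewrite /centre avg_mean_zero// subr0. Qed.

Lemma centre_lin a f g : centre (a *: f + g) = a *: centre f + centre g.
Proof.
apply/funext => x; rewrite /centre avgD avgZ !fctE /GRing.scale/=.
by rewrite mulrBr opprD addrACA.
Qed.

End Centring.

Section HaarSpan.
Context {R : realType} (p : R) (h : nat -> nat -> nat -> R -> R).
Hypothesis p1 : 1 < p.
Hypothesis mh : forall n k i, Domega (n, k, i) -> measurable_fun setT (h n k i).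
Hypothesis hdist : same_joint_dist h.
Hypothesis hindep : indep_blocks h.
Implicit Types (f g : R -> R) (G : forall n, atom n -> R).
Local Notation mu := (@mu01 R).
Local Notation Np f := (pnorm p f%R).

Let p0 : 0 < p. Proof. exact: lt_trans ltr01 p1. Qed.

Lemma in_span_measurable g : in_span h g -> measurable_fun setT g.
Proof.
move=> [s [c [ds ->]]]; elim: s ds => [|[[n k] i] s IH] /=.
  by move=> _; under eq_fun do rewrite big_nil; exact: measurable_cst.
move=> /andP[dj /IH ms]; under eq_fun do rewrite big_cons.
by apply: measurable_funD => //; apply: measurable_funM => //; exact: mh.
Qed.

Lemma in_span_lin a b f g : in_span h f -> in_span h g -> in_span h (a \*: f \+ b \*: g).
Proof.
move=> [s [c [ds ->]]] [s' [c' [ds' ->]]]; pose t := undup (s ++ s').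
have st : {subset s <= t} by move=> j js; rewrite mem_undup mem_cat js.
have s't : {subset s' <= t} by move=> j js; rewrite mem_undup mem_cat js orbT.
exists t, (fun j => a * ((count_mem j s)%:R * c j) + b * ((count_mem j s')%:R * c' j)).
split; first by apply/allP => j; rewrite mem_undup mem_cat => /orP[/(allP ds)|/(allP ds')].
apply/funext => x; rewrite /= -(sum_count_mem _ (undup_uniq _) st).
rewrite -(sum_count_mem _ (undup_uniq _) s't) /GRing.scale/= !mulr_sumr -big_split/=.
by apply: eq_bigr => j _; ring.
Qed.

Lemma pnorm_scale a f : measurable_fun setT f -> Np (a \*: f) = (`|a|%:E * Np f)%E.
Proof. by move=> mf; rewrite /pnorm Lnorm_scale. Qed.

Lemma ler_pnormD f g : measurable_fun setT f -> measurable_fun setT g ->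
  (Np (f \+ g) <= Np f + Np g)%E.
Proof. by move=> mf mg; exact: minkowski_EFin (ltW p1). Qed.

Lemma RpO_lin a b f g : RpO h p f -> RpO h p g -> RpO h p (a \*: f \+ b \*: g).
Proof.
move=> [mf happ] [mg gapp]; split.
  by apply: measurable_funD; exact: measurable_funM.
move=> e e0; pose c := `|a| + `|b| + 1; have c0 : 0 < c by rewrite ltr_wpDl ?addr_ge0.
have [f' [sf ff']] := happ _ (divr_gt0 e0 c0).
have [g' [sg gg']] := gapp _ (divr_gt0 e0 c0).
exists (a \*: f' \+ b \*: g'); split; first exact: in_span_lin.
have mff : measurable_fun setT (f \- f').
  by apply: measurable_funB => //; exact: in_span_measurable.
have mgg : measurable_fun setT (g \- g').
  by apply: measurable_funB => //; exact: in_span_measurable.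
have -> : (fun x => (a \*: f \+ b \*: g) x - (a \*: f' \+ b \*: g') x) =
    (a \*: (f \- f')) \+ (b \*: (g \- g')).
  by apply/funext => x; rewrite /= /GRing.scale/=; ring.
apply: le_lt_trans (ler_pnormD _ _) _; [exact: measurable_funM..|].
rewrite !pnorm_scale//.
apply: (@le_lt_trans _ _ (`|a|%:E * (e / c)%:E + `|b|%:E * (e / c)%:E)%E).
  by apply: leeD; apply: lee_wpmul2l => //; exact: ltW.
rewrite -!EFinM -EFinD lte_fin -mulrDl mulrCA gtr_pMr// ltr_pdivrMr// mul1r.
by rewrite /c; lra.
Qed.

Lemma RpO_limit f : measurable_fun setT f ->
  (forall e, 0 < e -> exists2 g, RpO h p g & (Np (f \- g) < e%:E)%E) -> RpO h p f.
Proof.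
move=> mf fapp; split => // e e0; have e20 : 0 < e / 2 by rewrite divr_gt0.
have [g [mg gapp] fg] := fapp _ e20; have [g' [sg gg']] := gapp _ e20.
exists g'; split => //.
have -> : (fun x => f x - g' x) = (f \- g) \+ (g \- g').
  by apply/funext => x; rewrite /= subrKA.
have mg' := in_span_measurable sg.
apply: le_lt_trans (ler_pnormD _ _) _; [exact: measurable_funB..|].
by rewrite [e]splitr EFinD lteD.
Qed.

Definition cell_sum M G : R -> R := fun x => \sum_(n < M) cell_fun h (G n) x.

Lemma measurable_cell_sum M G : measurable_fun setT (cell_sum M G).
Proof. by apply: measurable_sum => n; exact: measurable_cell_fun. Qed.

Lemma cell_sum_ae_in_span M G : (forall n, mean_zero (G n)) ->
  exists2 g, in_span h g & {ae mu, forall x, cell_sum M G x = g x}.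
Proof.
move=> mG; pose Gn n a := oapp (G n) 0 (insub a).
have GnE n (a : atom n) : Gn n a = G n a by rewrite /Gn valK.
have /choice[c cE] n : exists c : nat -> nat -> R, forall a : atom n,
    G n a = \sum_(k < n.+1) \sum_(i < 2 ^ k) c k i * haar_value n.+1 k i a.
  have [|c cE] := haar_expansion (n := n.+1) (f := Gn n).
    by rewrite -[RHS](mG n); apply: eq_bigr => a _; exact: GnE.
  by exists c => a; rewrite -GnE cE.
pose ki n := [seq (k, i) | k <- index_iota 0 n.+1, i <- index_iota 0 (2 ^ k)].
pose s := [seq (n.+1, q.1, q.2) | n <- index_iota 0 M, q <- ki n].
pose d (j : nat * nat * nat) := c j.1.1.-1 j.1.2 j.2.
exists (fun x => \sum_(j <- s) d j * h j.1.1 j.1.2 j.2 x).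
  exists s, d; split => //; apply/allP => j /allpairsPdep[n [q [_ + ->]]].
  move=> /allpairsPdep[k [i [+ + ->]]]; rewrite !mem_index_iota/= => kn ik.
  by rewrite kn ik.
have := ae_cells mh hdist; apply: filterS => x [a xa].
rewrite /cell_sum /s big_allpairs_dep big_mkord; apply: eq_bigr => n _.
rewrite (cell_funE _ (xa n)) cE /ki big_allpairs_dep big_mkord; apply: eq_bigr => k _.
rewrite big_mkord; apply: eq_bigr => i _; rewrite /d/=; congr (_ * _).
by rewrite (cell_value (xa n))// -ltnS.
Qed.

Lemma in_span_ae_cell_sum g : in_span h g ->
  exists M G, (forall n, mean_zero (G n)) /\ {ae mu, forall x, g x = cell_sum M G x}.
Proof.
move=> [s [c [/allP ds ->]]]; pose M := (\sum_(j <- s) j.1.1)%N.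
pose G n (a : atom n) := \sum_(j <- s | j.1.1 == n.+1) c j * haar_value n.+1 j.1.2 j.2 a.
exists M, G; split.
  move=> n; rewrite /mean_zero /G exchange_big/= big_seq_cond big1// => -[[m k] i] /=.
  move=> /andP[/ds /= /and3P[_ km ik] /eqP mn].
  by rewrite -mulr_sumr sum_haar_value ?mulr0// -mn.
have := ae_cells mh hdist; apply: filterS => x [a xa].
rewrite /cell_sum.
transitivity (\sum_(n < M) \sum_(j <- s)
    (if j.1.1 == n.+1 then c j * haar_value n.+1 j.1.2 j.2 (a n) else 0)); last first.
  by apply: eq_bigr => n _; rewrite (cell_funE _ (xa n)) [RHS]big_mkcond.
rewrite exchange_big/= big_seq [RHS]big_seq; apply: eq_bigr => -[[[//|m] k] i] js.
  by have := ds _ js.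
have /= /andP[km ik] := ds _ js.
have mM : (m < M)%N by rewrite /M (big_rem _ js)/= ltn_addr.
rewrite (bigD1 (Ordinal mM))//= eqxx big1 ?addr0; last first.
  by move=> n; rewrite -val_eqE/= eqSS eq_sym => /negbTE ->.
by rewrite (cell_value (xa m)).
Qed.

Lemma eq_ae_pnorm f g : measurable_fun setT f -> measurable_fun setT g ->
  {ae mu, forall x, f x = g x} -> Np f = Np g.
Proof. by move=> mf mg; exact: (eq_ae_Lnorm (mu := mu)). Qed.

Lemma RpO_cell_sum M G : (forall n, mean_zero (G n)) -> RpO h p (cell_sum M G).
Proof.
move=> mG; split; first exact: measurable_cell_sum.
move=> e e0; have [g sg Gg] := cell_sum_ae_in_span M mG; exists g; split => //.
rewrite (eq_ae_pnorm (g := cst 0)).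
- by rewrite /pnorm (_ : EFin \o _ = cst 0%E)// Lnorm0 ?lte_fin// eqe gt_eqF.
- apply: measurable_funB; [exact: measurable_cell_sum|exact: in_span_measurable].
- exact: measurable_cst.
- by apply: filterS Gg => x ->; rewrite subrr.
Qed.

Lemma RpO_approx f e : RpO h p f -> 0 < e -> exists M G,
  (forall n, mean_zero (G n)) /\ (Np (f \- cell_sum M G) < e%:E)%E.
Proof.
move=> [mf fapp] e0; have [g [sg fg]] := fapp e e0.
have [M [G [mG gG]]] := in_span_ae_cell_sum sg; exists M, G; split => //.
rewrite (eq_ae_pnorm (g := fun x => f x - g x))//.
- apply: measurable_funB => //; exact: measurable_cell_sum.
- apply: measurable_funB => //; exact: in_span_measurable.
- by apply: filterS gG => x gx; rewrite /= gx.
Qed.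

Lemma pnorm_sum_cell_fun (N : nat -> nat) (F : forall n, atom (N n) -> R) s :
  uniq [seq N n | n <- s] ->
  (Np (fun x => \sum_(n <- s) cell_fun h (F n) x) `^ p =
   (indep_mean (fun t => `|t| `^ p) F s 0)%:E)%E.
Proof.
move=> us; rewrite /pnorm poweR_Lnorm ?gt_eqF// -(law_cell_sum mh hdist hindep)//.
by apply/measurable_EFinP; exact: (measurable_norm_powR p (@measurable_id _ _ setT)).
Qed.

Lemma RpO_fin_num f : RpO h p f -> Np f \is a fin_num.
Proof.
move=> Rf; have [M [G [mG fG]]] := RpO_approx Rf ltr01; have [mf _] := Rf.
rewrite ge0_fin_numE ?Lnorm_ge0//.
have mG' := measurable_cell_sum M G.
have -> : f = (f \- cell_sum M G) \+ cell_sum M G.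
  by apply/funext => x; rewrite /= subrK.
apply: le_lt_trans (ler_pnormD _ _) _ => //; first exact: measurable_funB.
rewrite lte_add_pinfty ?(lt_trans fG)// ?ltry//.
apply: (@lty_poweRy _ _ p); first by rewrite gt_eqF.
have := pnorm_sum_cell_fun (N := id) G (s := index_iota 0 M).
rewrite map_id iota_uniq => /(_ isT); under eq_fun do rewrite big_mkord.
by rewrite -/(cell_sum M G) => ->; rewrite ltry.
Qed.

Definition haar_span_pred : {pred R -> R} := fun f => `[< RpO h p f >].

Lemma haar_span_closed : submod_closed haar_span_pred.
Proof.
split=> [|a f g /asboolP Rf /asboolP Rg]; apply/asboolP.
  have := RpO_cell_sum 0 (G := fun=> 0) (fun n => mean_zero0 _).
  by congr (RpO h p _); apply/funext => x; rewrite /cell_sum big_ord0.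
have := RpO_lin a 1 Rf Rg; congr (RpO h p _).
by apply/funext => x; rewrite /= scale1r.
Qed.

Definition haar_span : submodClosed (R -> R) :=
  HB.pack haar_span_pred (GRing.isSubmodClosed.Build _ _ haar_span_pred haar_span_closed).

Implicit Types (u v : submodule haar_span).

Lemma RpO_val v : RpO h p (val v).
Proof. exact/asboolP/(valP v). Qed.

Definition seminorm_val v : R := fine (Np (val v)).

Lemma seminorm_valE v : (seminorm_val v)%:E = Np (val v).
Proof. by rewrite /seminorm_val fineK// RpO_fin_num//; exact: RpO_val. Qed.

Lemma ler_seminorm_valD u v : seminorm_val (u + v) <= seminorm_val u + seminorm_val v.
Proof.
rewrite -lee_fin EFinD !seminorm_valE; apply: ler_pnormD.
- by have [] := RpO_val u.
- by have [] := RpO_val v.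
Qed.

Lemma seminorm_valZ a v : seminorm_val (a *: v) = `|a| * seminorm_val v.
Proof.
apply: EFin_inj; rewrite EFinM !seminorm_valE; have [mv _] := RpO_val v.
by rewrite linearZ/= (pnorm_scale a).
Qed.

Lemma seminorm_val_complete (v : nat -> submodule haar_span) :
  (forall k, seminorm_val (v k.+1 - v k) <= 2^-1 ^+ k) ->
  exists w, seminorm_val (w - v k) @[k --> \oo] --> 0.
Proof.
move=> fast; have mv k : measurable_fun setT (val (v k)) by have [] := RpO_val (v k).
have [|y my yv] := Lnorm_complete p1 (mu01_setT (R := R)) mv.
  by move=> k; have := fast k; rewrite -lee_fin seminorm_valE.
have cvg0 : 2 * 2^-1 ^+ k @[k --> \oo] --> (0 : R).
  by rewrite -[0 in X in _ --> X](mulr0 2); apply: cvgMr; exact: cvg_half_powers.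
have Ry : RpO h p y.
  apply: RpO_limit => // e e0; move/cvgrPdist_lt: cvg0 => /(_ _ e0)/filter_ex[k].
  rewrite sub0r normrN ger0_norm ?mulr_ge0 ?exprn_ge0 ?invr_ge0// => ke.
  by exists (val (v k)); [exact: RpO_val|rewrite (le_lt_trans (yv k))// lte_fin].
exists (exist _ y (asboolT Ry) : submodule haar_span).
apply: (squeeze_cvgr _ (cvg_cst 0) cvg0); apply: nearW => k.
rewrite -!lee_fin seminorm_valE; apply/andP; split; [exact: Lnorm_ge0|exact: yv].
Qed.

Definition haar_seminorm : complete_seminorm (submodule haar_span) :=
  CompleteSeminorm ler_seminorm_valD seminorm_valZ seminorm_val_complete.

Definition haar_space : completeNormedModType R := normed_quotient haar_seminorm.

Implicit Types x y : haar_space.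

(* Junk outside of [RpO h p]: the class of [0]. *)
Definition function_class f : haar_space := class haar_seminorm (insubd 0 f).

Definition class_function x : R -> R := val (representative x).

Lemma class_function_RpO x : RpO h p (class_function x).
Proof. exact: RpO_val. Qed.

Lemma class_functionK : cancel class_function function_class.
Proof. by move=> x; rewrite /function_class valKd; exact: representativeK. Qed.

Let insubdE f : RpO h p f -> val (insubd (0 : submodule haar_span) f) = f.
Proof. by move=> Rf; rewrite insubdK//; exact/asboolP. Qed.

Lemma norm_function_class f : RpO h p f -> `|function_class f|%:E = Np f.
Proof. by move=> Rf; rewrite norm_class seminorm_valE insubdE. Qed.

Lemma norm_class_function x : Np (class_function x) = `|x|%:E.
Proof. by rewrite -norm_function_class ?class_functionK//; exact: class_function_RpO. Qed.

Lemma function_class_lin a b f g : RpO h p f -> RpO h p g ->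
  function_class (a \*: f \+ b \*: g) = a *: function_class f + b *: function_class g.
Proof.
move=> Rf Rg; rewrite /function_class -!linearZ -linearD; congr class.
by apply: val_inj; rewrite /= !insubdE//; exact: RpO_lin.
Qed.

Lemma norm_function_classB f g : RpO h p f -> RpO h p g ->
  `|function_class f - function_class g|%:E = Np (f \- g).
Proof.
move=> Rf Rg; have -> : f \- g = 1 \*: f \+ (-1) \*: g.
  by apply/funext => t; rewrite /= scale1r scaleN1r.
by rewrite -norm_function_class ?function_class_lin ?scale1r ?scaleN1r//; exact: RpO_lin.
Qed.

Lemma function_class_eqP f g : RpO h p f -> RpO h p g ->
  function_class f = function_class g <-> aeq f g.
Proof.
move=> Rf Rg; have [mf _] := Rf; have [mg _] := Rg.
have mfg : measurable_fun setT (f \- g) by exact: measurable_funB.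
split=> [fg|fg].
  have := Lnorm_eq0 p1 (mu := mu) mfg.
  rewrite -/(pnorm p _) -norm_function_classB// fg subrr normr0 => /(_ erefl).
  by apply: filterS => t /eqP; rewrite /= subr_eq0 => /eqP.
apply/eqP; rewrite -subr_eq0 -normr_eq0 -eqe norm_function_classB//.
rewrite (eq_ae_pnorm (g := cst 0))//.
  by rewrite /pnorm (_ : EFin \o _ = cst 0%E)// Lnorm0// eqe gt_eqF.
by apply: filterS fg => t /= ->; rewrite subrr.
Qed.

Lemma RpO_cell_fun n (f : atom n -> R) : mean_zero f -> RpO h p (cell_fun h f).
Proof.
move=> mf; have [mG _] := single_finite mf.
have := RpO_cell_sum n.+1 mG; congr (RpO h p _); apply/funext => x; rewrite /cell_sum.
apply: (sum_single (V := R) f (g := fun k w => cell_fun h w x)) => k.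
by rewrite /cell_fun big1// => a _; rewrite mul0r.
Qed.

(* Centring makes the block total: [cell_fun h f] is in the space only for
   mean-zero [f]. *)
Definition haar_block n (f : atom n -> R) : haar_space :=
  function_class (cell_fun h (centre f)).
Arguments haar_block : clear implicits.

Let RpO_centre n (f : atom n -> R) : RpO h p (cell_fun h (centre f)).
Proof. by apply: RpO_cell_fun; apply: centre_mean_zero; exact: card_atom_gt0. Qed.

Lemma haar_block_lin n : linear (haar_block n).
Proof.
move=> a f g; rewrite /haar_block -[function_class (cell_fun h (centre g))]scale1r.
rewrite -function_class_lin//; congr function_class; apply/funext => x.
rewrite /= scale1r centre_lin /cell_fun /GRing.scale/= mulr_sumr -big_split/=.
by apply: eq_bigr => b _; rewrite !fctE /GRing.scale/= mulrDl mulrA.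
Qed.

HB.instance Definition _ n := GRing.isLinear.Build R (atom n -> R) haar_space *:%R
  (haar_block n) (@haar_block_lin n).

Lemma sum_haar_block (N : nat -> nat) (F : forall n, atom (N n) -> R) s :
  (forall n, mean_zero (F n)) ->
  RpO h p (fun t => \sum_(n <- s) cell_fun h (F n) t) /\
  \sum_(n <- s) haar_block (N n) (F n) =
    function_class (fun t => \sum_(n <- s) cell_fun h (F n) t).
Proof.
move=> mF; elim: s => [|n s [Rs IH]].
  have -> : (fun t => \sum_(n <- [::]) cell_fun h (F n) t) = \val (0 : submodule haar_span).
    by apply/funext => t; rewrite big_nil.
  split; first exact: RpO_val.
  by rewrite big_nil /function_class valKd linear0.
have Rn : RpO h p (cell_fun h (F n)) by exact: RpO_cell_fun.
have -> : (fun t => \sum_(m <- n :: s) cell_fun h (F m) t) =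
    1 \*: cell_fun h (F n) \+ 1 \*: (fun t => \sum_(m <- s) cell_fun h (F m) t).
  by apply/funext => t; rewrite big_cons /= !scale1r.
split; first exact: RpO_lin.
by rewrite big_cons IH function_class_lin// !scale1r /haar_block centre_id.
Qed.

Lemma haar_block_law (N : nat -> nat) (F : forall n, atom (N n) -> R) s :
  uniq [seq N n | n <- s] -> (forall n, mean_zero (F n)) ->
  `|\sum_(n <- s) haar_block (N n) (F n)| `^ p = indep_mean (fun t => `|t| `^ p) F s 0.
Proof.
move=> us mF; have [Rs ->] := sum_haar_block s mF.
by apply: EFin_inj; rewrite -pnorm_sum_cell_fun// -norm_function_class// poweR_EFin.
Qed.

Lemma haar_block_dense : closure [set x | exists M (G : forall n, atom n -> R),
  (forall n, mean_zero (G n)) /\ x = \sum_(n < M) haar_block n (G n)] = setT.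
Proof.
apply/seteqP; split => // x _ B /nbhs_ballP[e /= e0 eB].
have [M [G [mG xG]]] := RpO_approx (class_function_RpO x) e0.
exists (\sum_(n < M) haar_block n (G n)); split; first by exists M, G.
apply: eB; rewrite -ball_normE /= -lte_fin -[x]class_functionK.
have [RG] := sum_haar_block (N := id) (index_iota 0 M) mG; rewrite big_mkord => ->.
rewrite norm_function_classB//; last exact: class_function_RpO.
by move: xG; congr (Np _ < _)%E; apply/funext => t; rewrite /= /cell_sum big_mkord.
Qed.

Definition haar_blocks : block_system p haar_space :=
  BlockSystem haar_block_law haar_block_dense.

Lemma class_op (T : (R -> R) -> R -> R) (C : R) : bdd_op h p T C ->
  exists2 T' : {linear haar_space -> haar_space}, op_bound T' `|C| &
    forall f, RpO h p f -> T' (function_class f) = function_class (T f).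
Proof.
move=> [T_RpO T_lin T_bound].
have linT a b f g : RpO h p f -> RpO h p g -> function_class (T (a \*: f \+ b \*: g)) =
    a *: function_class (T f) + b *: function_class (T g).
  move=> Rf Rg; rewrite -function_class_lin; [|exact: T_RpO..].
  apply/function_class_eqP; [|by apply: RpO_lin; exact: T_RpO|exact: T_lin].
  by apply: T_RpO; exact: RpO_lin.
have boundT f : RpO h p f -> `|function_class (T f)| <= `|C| * `|function_class f|.
  move=> Rf; rewrite -lee_fin EFinM !norm_function_class//; last exact: T_RpO.
  apply: le_trans (T_bound f Rf) _; apply: lee_wpmul2r; first exact: Lnorm_ge0.
  by rewrite lee_fin ler_norm.
pose F x := function_class (T (class_function x)).
have FE f : RpO h p f -> F (function_class f) = function_class (T f).
  move=> Rf; set g := class_function (function_class f).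
  have Rg : RpO h p g by exact: class_function_RpO.
  apply/eqP; rewrite -subr_eq0 -normr_le0 -/g.
  have := boundT _ (RpO_lin 1 (-1) Rg Rf); rewrite linT// function_class_lin//.
  by rewrite !scale1r !scaleN1r class_functionK subrr normr0 mulr0.
have Flin : linear F.
  move=> a x y; have Rx := class_function_RpO x; have Ry := class_function_RpO y.
  have -> : a *: x + y = function_class (a \*: class_function x \+ 1 \*: class_function y).
    by rewrite function_class_lin// !class_functionK scale1r.
  by rewrite FE ?linT ?scale1r//; exact: RpO_lin.
pose LF : {linear haar_space -> haar_space} :=
  HB.pack F (GRing.isLinear.Build _ _ _ _ F Flin).
exists LF => [x|f Rf]; last exact: FE.
rewrite -[x in leRHS]class_functionK; exact/boundT/class_function_RpO.
Qed.

Definition function_op (A : haar_space -> haar_space) f : R -> R :=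
  class_function (A (function_class f)).

Lemma bdd_function_op (A : {linear haar_space -> haar_space}) (C : R) : op_bound A C ->
  bdd_op h p (function_op A) C.
Proof.
move=> bA; split=> [f Rf|f g a b Rf Rg|f Rf]; first exact: class_function_RpO.
- have RA f' := class_function_RpO (A (function_class f')).
  apply/function_class_eqP; [exact: RA|exact: (RpO_lin a b (RA f) (RA g))|].
  rewrite class_functionK; have -> := function_class_lin a b (RA f) (RA g).
  by have -> := function_class_lin a b Rf Rg; rewrite !class_functionK linearD !linearZ.
- by rewrite norm_class_function -norm_function_class// -EFinM lee_fin.
Qed.

Lemma haar_factor (T : (R -> R) -> R -> R) (C : R) : bdd_op h p T C ->
  exists S A B, [/\ S = T \/ S = IminusOp T, bdd_op h p A 4, bdd_op h p B 1 &
    forall f, RpO h p f -> aeq (A (S (B f))) f].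
Proof.
move=> bT; have [T_RpO _ _] := bT; have [T' bT' T'E] := class_op bT.
have [U [A [B [UT' bA bB AUB]]]] := factor_or_complement haar_blocks p1 bT'.
have [S ST SU] : exists2 S, S = T \/ S = IminusOp T & forall f, RpO h p f ->
    RpO h p (S f) /\ U (function_class f) = function_class (S f).
  case: UT' => UT'; [exists T|exists (IminusOp T)] => [|f Rf||f Rf]; [by left| |by right|].
    by split; [exact: T_RpO|rewrite UT' T'E].
  have RT := T_RpO _ Rf; have -> : IminusOp T f = 1 \*: f \+ (-1) \*: T f.
    by apply/funext => t; rewrite /= scale1r scaleN1r.
  by rewrite UT' function_class_lin// scale1r scaleN1r T'E//; split=> //; exact: RpO_lin.
exists S, (function_op A), (function_op B); split => //; [exact: bdd_function_op..|].
move=> f Rf; have RB : RpO h p (function_op B f) by exact: class_function_RpO.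
have [RS SE] := SU _ RB; apply/function_class_eqP => //; first exact: class_function_RpO.
by rewrite /function_op class_functionK -SE class_functionK AUB.
Qed.

End HaarSpan.

Lemma pstar_ge2 (R : realType) (p : R) : 1 < p -> 2 <= pstar p.
Proof.
move=> p1; rewrite /pstar /qconj le_max; apply/orP; case: (leP 2 p) => p2; [by left|right].
by rewrite ler_pdivlMr ?subr_gt0//; lra.
Qed.

Lemma fact_const_ge4 (R : realType) (p eps : R) : 1 < p -> 0 < eps -> eps < 1 ->
  4 <= fact_const p eps.
Proof.
move=> /pstar_ge2 ps2 e0 e1; have e1' : 0 < 1 - eps by rewrite subr_gt0.
have quot_ge4 : 4 <= 4 / (1 - eps) by rewrite ler_pdivlMr//; lra.
have sqr_ge1 : 1 <= (pstar p - 1) ^+ 2 by rewrite exprn_ege1//; lra.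
have pow_ge1 : 1 <= (pstar p / 2) `^ (3 / 2).
  rewrite -[leLHS](powRr0 (pstar p / 2)); apply: ler_powR; last by rewrite divr_ge0.
  by rewrite ler_pdivlMr// mul1r.
rewrite /fact_const -[leLHS]mulr1 ler_pM// -[leLHS]mulr1 ler_pM//.
Qed.

Theorem mainTheorem14 (R : realType) (p : R) (h : nat -> nat -> nat -> R -> R)
    (T : (R -> R) -> (R -> R)) (eps : R) :
  1 < p ->
  (forall n k i, Domega (n, k, i) -> measurable_fun setT (h n k i)) ->
  same_joint_dist h ->
  indep_blocks h ->
  (exists C : R, bdd_op h p T C) ->
  0 < eps -> eps < 1 ->
  exists S : (R -> R) -> (R -> R), (S = T \/ S = IminusOp T) /\
    exists (A B : (R -> R) -> (R -> R)) (a b : R),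
      [/\ 0 <= a, 0 <= b, bdd_op h p A a, bdd_op h p B b
        & a * b <= fact_const p eps] /\
      (forall f, RpO h p f -> aeq (A (S (B f))) f).
Proof.
move=> p1 mh hdist hindep [C bT] e0 e1.
have [S [A [B [ST bA bB ASB]]]] := haar_factor p1 mh hdist hindep bT.
exists S; split => //; exists A, B, 4, 1; split => //; split => //.
by rewrite mulr1; exact: fact_const_ge4.
Qed.
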